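(* Let $F,g:\mathbb R\to\mathbb R$ satisfy (H1), (H2) and (H3) of the context, let $a,c,L,l,I$ be as there, let $\mu>0$, and let $v_0$ be the positive zero of $v\mapsto I(v,-a,c)$. Put $$\kappa:=\left(2-\frac1l\right)\left(\frac{l}{l-1}\right)^{\frac{l-1}{2l-1}}\left(\max_{0\le x\le a}\{g(x)\}\cdot\int_0^{+\infty}\frac{\mathrm ds}{s^l+1}\right)^{\frac{l}{2l-1}}\left(\frac1L\right)^{\frac1{2l-1}}.$$ If $$\kappa\left(\frac1\mu\right)^{\frac{2l}{2l-1}}\le v_0,$$ then the amplitude of the limit cycle of the system $$\dot x=y-\mu F(x),\qquad \dot y=-g(x)$$ is greater than $c$.
   Context: Hypothesis (H1): $F$ and $g$ are odd functions in $C^1(\mathbb R)$, $g(x)>0$ for $x>0$, $F'(0)<0$, $F'$ has a unique positive zero, located at $x=a$, and $\lim_{x\to+\infty}F(x)=+\infty$. Under (H1), $F$ is strictly decreasing on $(-a,a)$ and strictly increasing elsewhere, $F$ has a unique positive zero $b>a$, and the equation $F(x)=F(-a)$ has a unique positive root $c$, with $c>b$. Hypothesis (H2): $F'(x)/g(x)$ is nondecreasing on $(0,c)$. Hypothesis (H3): $F(x)+F(a)\le -L\,(x+a)^l$ for all $x\in[-a,0]$, with some $l>1$ and $L>0$. For $v>0$ let $\bar\zeta(v)>c$ be the unique real root of $F(x)-F(c)=v$. For $v>0$ and $x,u<\bar\zeta(v)$ define $$I(v,x,u):=\int_x^u\frac{g(s)}{F(s)-F(c)-v}\,\mathrm ds.$$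 Under (H1) and (H2), the function $v\mapsto I(v,-a,c)$ has exactly one zero $v_0$ in $(0,+\infty)$. It is classical that under (H1), for every $\mu>0$, the system $\dot x=y-\mu F(x)$, $\dot y=-g(x)$ has a unique limit cycle, which is orbitally asymptotically stable and attracts every non-equilibrium solution. The amplitude of a limit cycle is the maximum of $|x|$ along the orbit. *)

(* Defs.v *)
From Stdlib Require Import Reals.
From Coquelicot Require Import Coquelicot.
Open Scope R_scope.

(* The power x ^ p for x >= 0 and p > 0.  Stdlib's Rpower 0 p equals 1 (since
   ln 0 = 0 there), whereas the value needed at 0 is 0. *)
Definition rpow (x p : R) : R := if Rlt_dec 0 x then Rpower x p else 0.

Definition odd_fun (f : R -> R) : Prop := forall x, f (- x) = - f x.

Definition C1 (f : R -> R) : Prop :=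
  forall x, ex_derive f x /\ continuous (Derive f) x.

Definition is_max (E : R -> Prop) (m : R) : Prop := E m /\ is_upper_bound E m.

Definition H1 (F g : R -> R) (a : R) : Prop :=
  odd_fun F /\ odd_fun g /\ C1 F /\ C1 g /\
  (forall x, 0 < x -> 0 < g x) /\
  Derive F 0 < 0 /\
  (0 < a /\ Derive F a = 0 /\ forall x, 0 < x -> Derive F x = 0 -> x = a) /\
  is_lim F p_infty p_infty.

Definition H2 (F g : R -> R) (c : R) : Prop :=
  forall x y, 0 < x -> x <= y -> y < c -> Derive F x / g x <= Derive F y / g y.

Definition H3 (F : R -> R) (a L l : R) : Prop :=
  1 < l /\ 0 < L /\
  forall x, - a <= x <= 0 -> F x + F a <= - L * rpow (x + a) l.

Definition Iint (F g : R -> R) (c v x u : R) : R :=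
  RInt (fun s => g s / (F s - F c - v)) x u.

(* M stands for the maximum of g on [0, a]. *)
Definition kappa (M L l : R) : R :=
  (2 - 1 / l) *
  rpow (l / (l - 1)) ((l - 1) / (2 * l - 1)) *
  rpow (M * RInt_gen (fun s => 1 / (rpow s l + 1))
              (at_point 0) (Rbar_locally p_infty))
       (l / (2 * l - 1)) *
  rpow (1 / L) (1 / (2 * l - 1)).

Definition lienard_solution (mu : R) (F g x y : R -> R) : Prop :=
  forall t, is_derive x t (y t - mu * F (x t)) /\ is_derive y t (- g (x t)).

(* Orbits are subsets of the phase plane. *)
Definition periodic_orbit (mu : R) (F g : R -> R) (G : R * R -> Prop) : Prop :=
  exists x y : R -> R,
    lienard_solution mu F g x y /\
    (exists T, 0 < T /\ forall t, x (t + T) = x t /\ y (t + T) = y t) /\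
    (exists t1 t2, (x t1, y t1) <> (x t2, y t2)) /\
    (forall p, G p <-> exists t, p = (x t, y t)).

(* A limit cycle is a periodic orbit having a neighbourhood that contains no
   other periodic orbit. *)
Definition limit_cycle (mu : R) (F g : R -> R) (G : R * R -> Prop) : Prop :=
  periodic_orbit mu F g G /\
  exists eps, 0 < eps /\
    forall G', periodic_orbit mu F g G' ->
      (forall p, G' p -> exists q, G q /\ ball q eps p) ->
      forall p, G' p <-> G p.

Definition is_amplitude (G : R * R -> Prop) (A : R) : Prop :=
  is_max (fun r => exists p, G p /\ r = Rabs (fst p)) A.

(* Main.v *)
Require Import Defs.
From Stdlib Require Import Reals Psatz IndefiniteDescription Classical.
From Coquelicot Require Import Coquelicot.
Open Scope R_scope.

(** Write v = y / mu - F c for the height of an orbit above the maximum F (-a) = F c,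
    and J for the integral of g / (F c + v0 - F) from 0; the definition of v0 says
    J (-a) = J c.  By (H2), in the variable J the function ln (F c + v0 - F) is convex
    over [-a, 0] and concave over [0, c], with the same end values, so F x <= F xi
    whenever J xi = J x with xi in (-a, 0) and x in (0, c).  Hence a curve over [-a, 0]
    that stays at heights 0 < v <= v0 and climbs at least as fast as the orbits do is
    reflected, by matching equal values of J, to a curve over [0, c] that descends at
    least as fast as the orbits do: an orbit passing x = 0 above it still has v > 0
    when it reaches x = c, and overshoots.

    A periodic orbit leaves the strip |x| <= a, since the energy increases along orbits
    inside it; by symmetry it crosses x = -a on its way up to x = 0.  If it passes
    x = 0 at height at most v0, its own arc is the left curve.  Otherwise the left curve
    is an explicit upper solution built from (H3), whose height at x = 0 is at most
    kappa (1 / mu)^(2l/(2l-1)) <= v0. *)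

(** * Calculus *)

Lemma continuous_eps (f : R -> R) (x : R) :
  continuous f x ->
  forall e, 0 < e -> exists d, 0 < d /\ forall y, Rabs (y - x) < d -> Rabs (f y - f x) < e.
Proof.
  intros Hf e He.
  destruct (proj1 (filterlim_locally f (f x)) Hf (mkposreal e He)) as [d Hd].
  exists d; split; [apply cond_pos|].
  intros y Hy; apply (Hd y Hy).
Qed.

Lemma derive_mvt (f : R -> R) (a b : R) :
  a < b ->
  (forall x, a < x < b -> ex_derive f x) ->
  (forall x, a <= x <= b -> continuous f x) ->
  exists x, a < x < b /\ f b - f a = Derive f x * (b - a).
Proof.
  intros Hab Hd Hc.
  (* [MVT_gen] may return an endpoint of the interval. Giving [df] there the value of the derivative
     at the midpoint turns an endpoint into an interior point. *)
  pose (df x := if Rlt_dec a x then if Rlt_dec x b then Derive f x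
                else Derive f ((a + b) / 2) else Derive f ((a + b) / 2)).
  destruct (MVT_gen f a b df) as [x [Hx Ex]].
  - rewrite Rmin_left, Rmax_right by lra.
    intros x Hx; unfold df.
    destruct (Rlt_dec a x); [|lra]. destruct (Rlt_dec x b); [|lra].
    apply Derive_correct, Hd; lra.
  - rewrite Rmin_left, Rmax_right by lra.
    intros x Hx; apply continuity_pt_filterlim, (Hc x Hx).
  - rewrite Rmin_left, Rmax_right in Hx by lra.
    unfold df in Ex.
    destruct (Rlt_dec a x); [destruct (Rlt_dec x b)|].
    + exists x; split; [lra|exact Ex].
    + exists ((a + b) / 2); split; [lra|exact Ex].
    + exists ((a + b) / 2); split; [lra|exact Ex].
Qed.

Lemma derive_le (f : R -> R) (k a b : R) :
  a <= b ->
  (forall x, a < x < b -> exists d, is_derive f x d /\ k <= d) ->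
  (forall x, a <= x <= b -> continuous f x) ->
  k * (b - a) <= f b - f a.
Proof.
  intros Hab Hd Hc.
  destruct (Req_dec a b) as [->|Hne]; [lra|].
  destruct (derive_mvt f a b) as [x [Hx Ex]]; [lra| |exact Hc|].
  - intros x Hx; destruct (Hd x Hx) as [d [H _]]; now exists d.
  - destruct (Hd x Hx) as [d [H Hk]].
    rewrite (is_derive_unique _ _ _ H) in Ex. rewrite Ex.
    apply Rmult_le_compat_r; lra.
Qed.

Lemma derive_lt (f : R -> R) (a b : R) :
  a < b ->
  (forall x, a < x < b -> exists d, is_derive f x d /\ 0 < d) ->
  (forall x, a <= x <= b -> continuous f x) ->
  f a < f b.
Proof.
  intros Hab Hd Hc.
  destruct (derive_mvt f a b) as [x [Hx Ex]]; [lra| |exact Hc|].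
  - intros x Hx; destruct (Hd x Hx) as [d [H _]]; now exists d.
  - destruct (Hd x Hx) as [d [H Hk]].
    rewrite (is_derive_unique _ _ _ H) in Ex.
    assert (0 < d * (b - a)) by (apply Rmult_lt_0_compat; lra). lra.
Qed.

Lemma derive_pos_local (f : R -> R) (x d : R) :
  is_derive f x d -> 0 < d ->
  exists e, 0 < e /\
    (forall y, x < y < x + e -> f x < f y) /\
    (forall y, x - e < y < x -> f y < f x).
Proof.
  intros Hf Hd.
  apply is_derive_Reals in Hf.
  destruct (Hf d Hd) as [e He].
  exists e; split; [apply cond_pos|].
  assert (K : forall h, h <> 0 -> Rabs h < e -> 0 < (f (x + h) - f x) / h).
  { intros h H0 H1. specialize (He h H0 H1). apply Rabs_def2 in He. lra. }
  split; intros y Hy.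
  - assert (H := K (y - x)). replace (x + (y - x)) with y in H by ring.
    assert (Hp : 0 < (f y - f x) / (y - x)).
    { apply H; [lra|]. rewrite Rabs_right; lra. }
    apply (Rmult_lt_compat_r (y - x)) in Hp; [|lra].
    replace ((f y - f x) / (y - x) * (y - x)) with (f y - f x) in Hp by (field; lra).
    lra.
  - assert (H := K (y - x)). replace (x + (y - x)) with y in H by ring.
    assert (Hp : 0 < (f y - f x) / (y - x)).
    { apply H; [lra|]. rewrite Rabs_left; lra. }
    apply (Rmult_lt_compat_r (x - y)) in Hp; [|lra].
    replace ((f y - f x) / (y - x) * (x - y)) with (f x - f y) in Hp by (field; lra).
    lra.
Qed.

(** The zero is the supremum of the points up to which f stays negative: if f were negative there,
    continuity would push the supremum further, and if f were positive there, it would already be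
    positive slightly before. *)
Lemma first_zero (f : R -> R) (a b : R) :
  a < b -> (forall x, a <= x <= b -> continuous f x) -> f a < 0 -> 0 <= f b ->
  exists z, a < z <= b /\ f z = 0 /\ forall x, a <= x < z -> f x < 0.
Proof.
  intros Hab Hc Ha Hb.
  pose (E x := a <= x <= b /\ forall y, a <= y <= x -> f y < 0).
  destruct (completeness E) as [z [Hu Hl]].
  - exists b; intros x [Hx _]; lra.
  - exists a; split; [lra|]. intros y Hy; now replace y with a by lra.
  - assert (Haz : a <= z).
    { apply Hu; split; [lra|]. intros y Hy; now replace y with a by lra. }
    assert (Hzb : z <= b) by (apply Hl; intros x [Hx _]; lra).
    assert (Hneg : forall x, a <= x < z -> f x < 0).
    { intros x Hx. destruct (Rlt_dec (f x) 0) as [|Hn]; [assumption|exfalso].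
      assert (z <= x); [|lra].
      apply Hl; intros w [Hw1 Hw2].
      destruct (Rle_dec w x) as [|Hwx]; [assumption|].
      exfalso; apply Hn, Hw2; lra. }
    assert (Hz0 : f z = 0).
    { destruct (Rtotal_order (f z) 0) as [Hz|[Hz|Hz]]; [|assumption|]; exfalso.
      - destruct (continuous_eps f z (Hc z (conj Haz Hzb)) (- f z)) as [d [Hd Hd']]; [lra|].
        assert (Hzb' : z <> b) by (intros ->; lra).
        pose (w := Rmin b (z + d / 2)).
        assert (z < w) by (unfold w; apply Rmin_glb_lt; lra).
        assert (w <= b) by apply Rmin_l. assert (w <= z + d / 2) by apply Rmin_r.
        assert (w <= z); [|lra].
        apply Hu; split; [lra|]. intros y Hy.
        destruct (Rlt_dec y z) as [Hyz|Hyz]; [apply Hneg; lra|].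
        assert (HH : Rabs (f y - f z) < - f z) by (apply Hd'; rewrite Rabs_right; lra).
        apply Rabs_def2 in HH; lra.
      - destruct (continuous_eps f z (Hc z (conj Haz Hzb)) (f z)) as [d [Hd Hd']]; [lra|].
        assert (Haz' : z <> a) by (intros ->; lra).
        pose (w := Rmax a (z - d / 2)).
        assert (w < z) by (unfold w; apply Rmax_lub_lt; lra).
        assert (a <= w) by apply Rmax_l. assert (z - d / 2 <= w) by apply Rmax_r.
        assert (HH : Rabs (f w - f z) < f z) by (apply Hd'; rewrite Rabs_left; lra).
        apply Rabs_def2 in HH.
        assert (f w < 0) by (apply Hneg; lra). lra. }
    exists z; split; [|split; assumption].
    split; [|assumption].
    destruct (Req_dec a z) as [E0|]; [|lra]. rewrite <- E0 in Hz0; lra.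
Qed.

Lemma last_zero (f : R -> R) (a b : R) :
  a < b -> (forall x, a <= x <= b -> continuous f x) -> 0 <= f a -> f b < 0 ->
  exists z, a <= z < b /\ f z = 0 /\ forall x, z < x <= b -> f x < 0.
Proof.
  intros Hab Hc Ha Hb.
  destruct (first_zero (fun x => f (a + b - x)) a b Hab) as [z [Hz [Hz0 Hz1]]].
  - intros x Hx. apply (continuous_comp (fun x => a + b - x) f).
    + apply (continuous_minus (fun _ => a + b) (fun x => x));
        [apply continuous_const|apply continuous_id].
    + apply Hc; lra.
  - now replace (a + b - a) with b by ring.
  - now replace (a + b - b) with a by ring.
  - exists (a + b - z); split; [lra|]; split; [assumption|].
    intros x Hx. replace x with (a + b - (a + b - x)) by ring. apply Hz1; lra.
Qed.

(* No continuity of [D] at [t0] is asked for; a lower bound that is continuous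
   there and starts nonnegative replaces it. *)
Lemma gronwall_nonneg (D u : R -> R) (K t0 t1 : R) :
  0 <= K -> t0 < t1 ->
  (forall t, t0 < t < t1 -> exists d, is_derive D t d /\ (D t < 0 -> K * D t <= d)) ->
  (forall t, t0 < t < t1 -> u t <= D t) ->
  continuous u t0 -> 0 <= u t0 ->
  forall t, t0 < t < t1 -> 0 <= D t.
Proof.
  intros HK H01 HD Hu Cu Hu0 t Ht.
  destruct (Rle_dec 0 (D t)) as [|Hneg]; [assumption|exfalso].
  apply Rnot_le_lt in Hneg.
  assert (CD : forall s, t0 < s < t1 -> continuous D s).
  { intros s Hs. destruct (HD s Hs) as [d [Hd _]].
    apply (ex_derive_continuous D). now exists d. }
  pose (E s := D s * exp (- K * s)).
  assert (Emon : forall p q, t0 < p -> p <= q -> q < t1 ->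
            (forall s, p < s < q -> D s < 0) -> E p <= E q).
  { intros p q Hp Hpq Hq Hs.
    assert (H := derive_le E 0 p q Hpq). rewrite Rmult_0_l in H.
    cut (0 <= E q - E p); [lra|]. apply H; clear H.
    - intros x Hx. destruct (HD x) as [d [Hd Hd']]; [lra|].
      exists ((d - K * D x) * exp (- K * x)). split.
      + unfold E. evar_last.
        * apply (is_derive_mult D (fun s => exp (- K * s)) x d (- K * exp (- K * x)));
            [exact Hd| |intros; apply Rmult_comm].
          auto_derive; [exact I|ring].
        * unfold plus, mult; simpl; ring.
      + apply Rmult_le_pos; [|left; apply exp_pos].
        assert (HH := Hd' (Hs x Hx)). lra.
    - intros x Hx. unfold E.
      apply (continuous_mult D (fun s => exp (- K * s))); [apply CD; lra|].
      apply (ex_derive_continuous (fun s => exp (- K * s))). auto_derive; exact I. }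
  assert (Eneg : E t < 0).
  { unfold E. assert (0 < exp (- K * t)) by apply exp_pos. nra. }
  (* Going back from [t], [D] stays negative down to t0: at its last zero z before [t] one would
     have 0 = E z <= E t < 0. *)
  assert (Hall : forall s, t0 < s <= t -> D s < 0).
  { intros s Hs. destruct (Rlt_dec (D s) 0) as [|Hn]; [assumption|exfalso].
    apply Rnot_lt_le in Hn.
    assert (s < t) by (destruct (Req_dec s t) as [->|]; lra).
    destruct (last_zero D s t) as [z [Hz [Hz0 Hz1]]]; try assumption.
    - intros x Hx; apply CD; lra.
    - assert (HE : E z <= E t) by (apply Emon; try lra; intros; apply Hz1; lra).
      assert (E z = 0) by (unfold E; rewrite Hz0; ring). lra. }
  (* Monotonicity of [E] gives D s <= -eta for every s in (t0, t], whereas u s > -eta near t0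
     because u is continuous and nonnegative at t0. *)
  pose (eta := - (D t * exp (- K * (t - t0)))).
  assert (Heta : 0 < eta).
  { unfold eta. assert (0 < exp (- K * (t - t0))) by apply exp_pos. nra. }
  destruct (continuous_eps u t0 Cu eta Heta) as [d [Hd Hd']].
  pose (s := Rmin t (t0 + d / 2)).
  assert (t0 < s) by (unfold s; apply Rmin_glb_lt; lra).
  assert (s <= t) by apply Rmin_l. assert (s <= t0 + d / 2) by apply Rmin_r.
  assert (Hs1 : Rabs (u s - u t0) < eta) by (apply Hd'; rewrite Rabs_right; lra).
  apply Rabs_def2 in Hs1.
  assert (Hs2 : u s <= D s) by (apply Hu; lra).
  assert (Hs3 : E s <= E t) by (apply Emon; try lra; intros; apply Hall; lra).
  assert (D s <= - eta); [|lra].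
  assert (Hs4 : D s <= D t * exp (- K * (t - s))).
  { replace (exp (- K * (t - s))) with (exp (- K * t) * exp (K * s))
      by (rewrite <- exp_plus; f_equal; ring).
    replace (D s) with (E s * exp (K * s)).
    - rewrite <- Rmult_assoc. apply Rmult_le_compat_r; [left; apply exp_pos|exact Hs3].
    - unfold E. rewrite Rmult_assoc, <- exp_plus.
      replace (- K * s + K * s) with 0 by ring. rewrite exp_0; ring. }
  assert (Hs5 : exp (- K * (t - t0)) <= exp (- K * (t - s))).
  { destruct (Req_dec (- K * (t - t0)) (- K * (t - s))) as [E0|E0].
    - rewrite E0; lra.
    - left; apply exp_increasing. nra. }
  unfold eta. nra.
Qed.

(** Preimages exist by the intermediate value property and are picked by choice. Strict monotonicity
    makes [r] continuous, and its difference quotients are the reciprocals of those of f. It serves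
    to parametrise a left curve by its potential. *)
Lemma decreasing_inverse (f : R -> R) (a b : R) :
  a < b ->
  (forall x, a <= x <= b -> continuous f x) ->
  (forall x y, a <= x -> x < y -> y <= b -> f y < f x) ->
  exists r : R -> R, forall y, f b < y < f a ->
    a < r y < b /\ f (r y) = y /\
    forall d, is_derive f (r y) d -> d <> 0 -> is_derive r y (/ d).
Proof.
  intros Hab Hc Hdec.
  destruct (functional_choice (fun y z => f b < y < f a -> a < z < b /\ f z = y)) as [r Hr].
  { intros y. destruct (Rlt_dec (f b) y); [|exists 0; lra].
    destruct (Rlt_dec y (f a)); [|exists 0; lra].
    destruct (first_zero (fun x => y - f x) a b Hab) as [z [Hz [Hz0 _]]]; try lra.
    - intros x Hx. apply (continuous_minus (fun _ => y) f);
        [apply continuous_const|apply Hc, Hx].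
    - exists z; intros _; split; [|lra]. split; [lra|].
      destruct (Req_dec z b) as [->|]; lra. }
  exists r. intros y Hy. destruct (Hr y Hy) as [Hz Hfz].
  split; [exact Hz|split; [exact Hfz|]].
  intros d Hd Hd0.
  assert (Cr : forall e, 0 < e -> exists del, 0 < del /\
            forall k, Rabs k < del -> f b < y + k < f a /\ Rabs (r (y + k) - r y) < e).
  { intros e He.
    pose (e' := Rmin (e / 2) (Rmin ((r y - a) / 2) ((b - r y) / 2))).
    assert (0 < e') by (unfold e'; repeat apply Rmin_glb_lt; lra).
    assert (e' <= e / 2) by apply Rmin_l.
    assert (e' <= (r y - a) / 2) by (eapply Rle_trans; [apply Rmin_r|apply Rmin_l]).
    assert (e' <= (b - r y) / 2) by (eapply Rle_trans; [apply Rmin_r|apply Rmin_r]).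
    assert (G1 := Hdec (r y - e') (r y) ltac:(lra) ltac:(lra) ltac:(lra)).
    assert (G2 := Hdec (r y) (r y + e') ltac:(lra) ltac:(lra) ltac:(lra)).
    exists (Rmin (f (r y - e') - y) (y - f (r y + e'))).
    split; [apply Rmin_glb_lt; lra|].
    intros k Hk.
    assert (Hk1 := Rlt_le_trans _ _ _ Hk (Rmin_l _ _)).
    assert (Hk2 := Rlt_le_trans _ _ _ Hk (Rmin_r _ _)).
    apply Rabs_def2 in Hk1. apply Rabs_def2 in Hk2.
    assert (G3 := Hdec a (r y - e') ltac:(lra) ltac:(lra) ltac:(lra)).
    assert (G4 := Hdec (r y + e') b ltac:(lra) ltac:(lra) ltac:(lra)).
    assert (Hyk : f b < y + k < f a) by lra.
    split; [exact Hyk|].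
    destruct (Hr _ Hyk) as [Hz' Hfz'].
    assert (r y - e' < r (y + k)).
    { apply Rnot_le_lt; intros Hle.
      destruct (Req_dec (r (y + k)) (r y - e')) as [E0|E0]; [rewrite E0 in Hfz'; lra|].
      assert (G5 := Hdec (r (y + k)) (r y - e') ltac:(lra) ltac:(lra) ltac:(lra)). lra. }
    assert (r (y + k) < r y + e').
    { apply Rnot_le_lt; intros Hle.
      destruct (Req_dec (r (y + k)) (r y + e')) as [E0|E0]; [rewrite E0 in Hfz'; lra|].
      assert (G5 := Hdec (r y + e') (r (y + k)) ltac:(lra) ltac:(lra) ltac:(lra)). lra. }
    apply Rabs_def1; lra. }
  apply is_derive_Reals. apply is_derive_Reals in Hd.
  intros e He.
  assert (Ci : continuous Rinv d) by (apply continuous_Rinv, Hd0).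
  destruct (continuous_eps Rinv d Ci e He) as [e1 [He1 He1']].
  destruct (Hd e1 He1) as [e2 He2].
  destruct (Cr e2 (cond_pos e2)) as [e3 [He3 He3']].
  exists (mkposreal e3 He3). intros k Hk0 Hk. simpl in Hk.
  destruct (He3' k Hk) as [Hyk Hrk].
  destruct (Hr _ Hyk) as [Hz' Hfz'].
  assert (Hne : r (y + k) - r y <> 0).
  { intros E0. apply Hk0. replace (r (y + k)) with (r y) in Hfz' by lra. lra. }
  assert (H := He1' _ (He2 _ Hne Hrk)).
  replace (r y + (r (y + k) - r y)) with (r (y + k)) in H by ring.
  rewrite Hfz', Hfz in H. replace (y + k - y) with k in H by ring.
  replace ((r (y + k) - r y) / k) with (/ (k / (r (y + k) - r y))) by (field; split; assumption).
  exact H.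
Qed.

(** * Potential and reflection *)

Lemma odd_fun_0 (f : R -> R) : odd_fun f -> f 0 = 0.
Proof. intros Hf. assert (H := Hf 0). rewrite Ropp_0 in H. lra. Qed.

Lemma Derive_odd_fun (f : R -> R) (x : R) :
  odd_fun f -> (forall y, ex_derive f y) -> Derive f (- x) = Derive f x.
Proof.
  intros Hf Hd.
  assert (E : Derive (fun y => - f (- y)) x = Derive f x)
    by (apply Derive_ext; intros y; rewrite Hf; ring).
  rewrite <- E. symmetry. apply is_derive_unique.
  auto_derive; [apply Hd|].
  change (Derive (fun x0 : R => f x0) (-x)) with (Derive f (-x)). ring.
Qed.

Lemma H1_derive (F g : R -> R) (a x : R) : H1 F g a -> is_derive F x (Derive F x).
Proof. intros (_ & _ & HF & _). apply Derive_correct, HF. Qed.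

Lemma H1_continuous (F g : R -> R) (a x : R) :
  H1 F g a -> continuous F x /\ continuous g x.
Proof.
  intros (_ & _ & HF & Hg & _).
  split; [apply (ex_derive_continuous F), HF|apply (ex_derive_continuous g), Hg].
Qed.

(** F' is negative at 0 and has no zero in (0, a), so it cannot change sign there; negative
    arguments follow because F' is even. *)
Lemma H1_Derive_neg (F g : R -> R) (a x : R) :
  H1 F g a -> - a < x < a -> Derive F x < 0.
Proof.
  intros (oF & _ & HF & _ & _ & HF0 & (Ha & HFa & Huniq) & _) Hx.
  assert (pos : forall y, 0 < y < a -> Derive F y < 0).
  { intros y Hy. destruct (Rlt_dec (Derive F y) 0) as [|Hn]; [assumption|exfalso].
    destruct (first_zero (Derive F) 0 y) as [z [Hz [Hz0 _]]]; try lra.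
    - intros w _. apply HF.
    - assert (z = a) by (apply Huniq; lra). lra. }
  destruct (Rtotal_order x 0) as [H|[->|H]]; [|exact HF0|apply pos; lra].
  rewrite <- (Ropp_involutive x), Derive_odd_fun; [apply pos; lra|exact oF|apply HF].
Qed.

Lemma H1_decreasing (F g : R -> R) (a x y : R) :
  H1 F g a -> - a <= x -> x < y -> y <= a -> F y < F x.
Proof.
  intros HH Hx Hxy Hy.
  cut (- F x < - F y); [lra|].
  apply (derive_lt (fun z => - F z)); [assumption| |].
  - intros z Hz. exists (- Derive F z). split.
    + apply (is_derive_opp F), (H1_derive F g a), HH.
    + assert (H := H1_Derive_neg F g a z HH). lra.
  - intros z _. apply (continuous_opp F), (H1_continuous F g a z HH).
Qed.

(** F c = F (-a) is positive, while F is negative on (0, a]. *)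
Lemma H1_a_lt_c (F g : R -> R) (a c : R) :
  H1 F g a -> 0 < c -> F c = F (- a) -> a < c.
Proof.
  intros HH Hc Ec.
  assert (Ha : 0 < a) by apply HH.
  assert (E0 := odd_fun_0 F (proj1 HH)).
  assert (L0 := H1_decreasing F g a (- a) 0 HH).
  destruct (Rlt_dec a c) as [|Hn]; [assumption|exfalso].
  assert (L1 := H1_decreasing F g a 0 c HH). lra.
Qed.

(** The quotient F'/g vanishes at a and is nondecreasing, so F' >= 0 on (a, c); equality is excluded
    since a is the only positive zero of F'. *)
Lemma H2_increasing (F g : R -> R) (a c x y : R) :
  H1 F g a -> H2 F g c -> 0 < c -> F c = F (- a) ->
  a <= x -> x < y -> y <= c -> F x < F y.
Proof.
  intros HH HH2 Hc Ec Hx Hxy Hy.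
  assert (Hac := H1_a_lt_c F g a c HH Hc Ec).
  destruct HH as (oF & og & HF & Hg & Hgp & HF0 & (Ha & HFa & Huniq) & Hlim).
  apply derive_lt; [assumption| |].
  - intros z Hz. exists (Derive F z). split; [apply Derive_correct, HF|].
    assert (H := HH2 a z Ha ltac:(lra) ltac:(lra)).
    rewrite HFa in H. assert (Gz := Hgp z ltac:(lra)).
    assert (Hz0 : 0 <= Derive F z).
    { replace (Derive F z) with (Derive F z / g z * g z) by (field; lra).
      apply Rmult_le_pos; [|lra]. unfold Rdiv in H at 1. lra. }
    destruct Hz0 as [|E0]; [assumption|].
    assert (z = a) by (apply Huniq; lra). lra.
  - intros z _. apply (ex_derive_continuous F), HF.
Qed.

Lemma F_lt_max (F g : R -> R) (a c x : R) :
  H1 F g a -> H2 F g c -> 0 < c -> F c = F (- a) -> - a < x < c -> F x < F c.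
Proof.
  intros HH HH2 Hc Ec Hx.
  assert (Hac := H1_a_lt_c F g a c HH Hc Ec).
  destruct (Rle_dec x a).
  - rewrite Ec. apply (H1_decreasing F g a); lra || assumption.
  - apply (H2_increasing F g a c); lra || assumption.
Qed.

Lemma F_le_max (F g : R -> R) (a c x : R) :
  H1 F g a -> H2 F g c -> 0 < c -> F c = F (- a) -> - a <= x <= c -> F x <= F c.
Proof.
  intros HH HH2 Hc Ec Hx.
  destruct (Req_dec x (- a)) as [->|]; [lra|].
  destruct (Req_dec x c) as [->|]; [lra|].
  left; apply (F_lt_max F g a); try assumption; lra.
Qed.

(* On [-a, c] this is minus the integrand of [Iint]; the [Rmax] only serves to
   make it continuous on the whole line. *)
Definition potential_density (F g : R -> R) (c v s : R) : R :=
  g s / Rmax v (F c + v - F s).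

(** For v = v0 this is the J of the overview; on [-a, c] it equals -I(v, 0, x). *)
Definition potential (F g : R -> R) (c v x : R) : R :=
  RInt (potential_density F g c v) 0 x.

Lemma continuous_Rmax_const (f : R -> R) (k x : R) :
  continuous f x -> continuous (fun y => Rmax k (f y)) x.
Proof.
  intros Hf. apply filterlim_locally. intros e.
  generalize (proj1 (filterlim_locally f (f x)) Hf e).
  apply filter_imp. intros y Hy.
  unfold ball in *; simpl in *; unfold AbsRing_ball, abs, minus, plus, opp in *; simpl in *.
  apply Rabs_def2 in Hy. assert (He := cond_pos e).
  unfold Rmax. destruct (Rle_dec k (f y)), (Rle_dec k (f x)); apply Rabs_def1; lra.
Qed.

Lemma is_derive_potential (F g : R -> R) (a c v x : R) :
  H1 F g a -> 0 < v ->
  is_derive (potential F g c v) x (potential_density F g c v x).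
Proof.
  intros HH Hv.
  assert (C : forall y, continuous (potential_density F g c v) y).
  { intros y. destruct (H1_continuous F g a y HH) as [CF Cg].
    apply (continuous_mult g (fun s => / Rmax v (F c + v - F s))); [exact Cg|].
    apply (continuous_comp (fun s => Rmax v (F c + v - F s)) Rinv).
    - apply continuous_Rmax_const.
      apply (continuous_minus (fun _ => F c + v) F); [apply continuous_const|exact CF].
    - apply continuous_Rinv. assert (H := Rmax_l v (F c + v - F y)). lra. }
  apply (is_derive_RInt _ _ 0); [|apply C].
  apply filter_forall. intros y. apply (RInt_correct (V := R_CompleteNormedModule)).
  apply (ex_RInt_continuous (V := R_CompleteNormedModule)); intros; apply C.
Qed.

Lemma continuous_potential (F g : R -> R) (a c v x : R) :
  H1 F g a -> 0 < v -> continuous (potential F g c v) x.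
Proof.
  intros HH Hv. apply (ex_derive_continuous (potential F g c v)).
  eexists; apply (is_derive_potential F g a); assumption.
Qed.

Lemma potential_0 (F g : R -> R) (c v : R) : potential F g c v 0 = 0.
Proof. apply (RInt_point (V := R_CompleteNormedModule)). Qed.

Lemma potential_density_eq (F g : R -> R) (a c v x : R) :
  H1 F g a -> H2 F g c -> 0 < c -> F c = F (- a) -> - a <= x <= c ->
  potential_density F g c v x = g x / (F c + v - F x).
Proof.
  intros HH HH2 Hc Ec Hx. unfold potential_density.
  assert (H := F_le_max F g a c x HH HH2 Hc Ec Hx).
  rewrite Rmax_right; lra || reflexivity.
Qed.

Lemma g_neg (F g : R -> R) (a x : R) : H1 F g a -> x < 0 -> g x < 0.
Proof.
  intros (_ & og & _ & _ & gp & _) Hx.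
  rewrite <- (Ropp_involutive x), og. assert (H := gp (- x)). lra.
Qed.

Lemma potential_increasing (F g : R -> R) (a c v x y : R) :
  H1 F g a -> 0 < v -> 0 <= x -> x < y ->
  potential F g c v x < potential F g c v y.
Proof.
  intros HH Hv Hx Hxy. apply derive_lt; [assumption| |].
  - intros z Hz. eexists. split; [apply (is_derive_potential F g a); assumption|].
    apply Rdiv_lt_0_compat; [apply HH; lra|].
    assert (H := Rmax_l v (F c + v - F z)). lra.
  - intros z _. apply (continuous_potential F g a); assumption.
Qed.

Lemma potential_decreasing (F g : R -> R) (a c v x y : R) :
  H1 F g a -> 0 < v -> x < y -> y <= 0 ->
  potential F g c v y < potential F g c v x.
Proof.
  intros HH Hv Hxy Hy.
  cut (- potential F g c v x < - potential F g c v y); [lra|].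
  apply (derive_lt (fun z => - potential F g c v z)); [assumption| |].
  - intros z Hz. eexists. split.
    + apply (is_derive_opp (potential F g c v)), (is_derive_potential F g a); assumption.
    + change (0 < - potential_density F g c v z). unfold potential_density, Rdiv.
      rewrite Ropp_mult_distr_l.
      apply Rdiv_lt_0_compat; [assert (H := g_neg F g a z HH); lra|].
      assert (H := Rmax_l v (F c + v - F z)). lra.
  - intros z _. apply (continuous_opp (potential F g c v)), (continuous_potential F g a); assumption.
Qed.

(** Between -a and c the integrand of [Iint] is minus the derivative of the potential, so [Iint] is
    J (-a) - J c. *)
Lemma potential_balance (F g : R -> R) (a c v : R) :
  H1 F g a -> H2 F g c -> 0 < c -> F c = F (- a) -> 0 < v ->
  Iint F g c v (- a) c = 0 -> potential F g c v (- a) = potential F g c v c.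
Proof.
  intros HH HH2 Hc Ec Hv HI.
  assert (Ha : 0 < a) by apply HH.
  assert (K : is_RInt (potential_density F g c v) (- a) c
                (potential F g c v c - potential F g c v (- a))).
  { apply (is_RInt_derive (potential F g c v)).
    - intros x _. apply (is_derive_potential F g a); assumption.
    - intros y _. destruct (H1_continuous F g a y HH) as [CF Cg].
      apply (continuous_mult g (fun s => / Rmax v (F c + v - F s))); [exact Cg|].
      apply (continuous_comp (fun s => Rmax v (F c + v - F s)) Rinv).
      + apply continuous_Rmax_const.
        apply (continuous_minus (fun _ => F c + v) F); [apply continuous_const|exact CF].
      + apply continuous_Rinv. assert (H := Rmax_l v (F c + v - F y)). lra. }
  assert (K' : is_RInt (fun s => g s / (F s - F c - v)) (- a) c
                (- (potential F g c v c - potential F g c v (- a)))).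
  { apply (is_RInt_ext (fun s => - potential_density F g c v s)).
    - intros s. rewrite Rmin_left, Rmax_right by lra. intros Hs.
      rewrite (potential_density_eq F g a) by (assumption || lra).
      assert (H := F_lt_max F g a c s HH HH2 Hc Ec Hs).
      change (- (g s / (F c + v - F s)) = g s / (F s - F c - v)). field. lra.
    - apply (is_RInt_opp (potential_density F g c v)), K. }
  apply (is_RInt_unique (V := R_CompleteNormedModule)) in K'. unfold Iint in HI. lra.
Qed.

(* In the variable [potential], condition (H2) makes [ln (F c + v - F)] convex on
   the left branch and concave on the right branch, and the two branches share
   their end values. *)
Lemma F_matched_le (F g : R -> R) (a c v xi x : R) :
  H1 F g a -> H2 F g c -> 0 < c -> F c = F (- a) -> 0 < v ->
  Iint F g c v (- a) c = 0 ->
  - a < xi < 0 -> 0 < x < c -> potential F g c v xi = potential F g c v x ->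
  F x <= F xi.
Proof.
  intros HH HH2 Hc Ec Hv HI Hxi Hx HJ.
  assert (Hac := H1_a_lt_c F g a c HH Hc Ec).
  assert (HT := potential_balance F g a c v HH HH2 Hc Ec Hv HI).
  assert (E0 := potential_0 F g c v).
  assert (F0 := odd_fun_0 F (proj1 HH)).
  set (J := potential F g c v) in *.
  set (q y := ln (F c + v - F y)).
  assert (pos : forall y, - a <= y <= c -> 0 < F c + v - F y).
  { intros y Hy. assert (H := F_le_max F g a c y HH HH2 Hc Ec Hy). lra. }
  assert (Dq : forall y m, - a <= y <= c ->
     is_derive (fun z => q z + m * J z) y (- Derive F y / (F c + v - F y) + m * (g y / (F c + v - F y)))).
  { intros y m Hy. rewrite <- (potential_density_eq F g a) by assumption.
    apply (is_derive_plus q (fun z => m * J z)).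
    - unfold q. evar_last.
      + apply (is_derive_comp ln (fun z => F c + v - F z)).
        * apply is_derive_Reals, derivable_pt_lim_ln, pos, Hy.
        * apply (is_derive_minus (fun _ => F c + v) F);
            [apply is_derive_const|apply (H1_derive F g a), HH].
      + unfold scal, minus, plus, opp, zero, mult; simpl. unfold mult; simpl. unfold Rdiv. ring.
    - apply (is_derive_scal J), (is_derive_potential F g a); assumption. }
  assert (Cq : forall y m, - a <= y <= c -> continuous (fun z => q z + m * J z) y).
  { intros y m Hy. apply (ex_derive_continuous (fun z => q z + m * J z)).
    eexists. apply Dq, Hy. }
  (* Tangent slopes at the matched points: as a function of J, the logarithm [q] has derivative
     -F'/g, which is -m0 at x and, by parity, m1 at xi. By concavity q + m0 J is largest at x over
     [0, c] ([R1], [R2]); by convexity q - m1 J is smallest at xi over [-a, 0] ([L1], [L2]). *)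
  pose (m0 := Derive F x / g x). pose (m1 := Derive F (- xi) / g (- xi)).
  assert (gp : forall y, 0 < y -> 0 < g y) by apply HH.
  assert (sgn : forall A B P, 0 < P -> 0 <= A * B -> 0 <= A * (B / P)).
  { intros A B P HP HAB. replace (A * (B / P)) with (A * B * / P) by (unfold Rdiv; ring).
    apply Rmult_le_pos; [exact HAB|left; apply Rinv_0_lt_compat, HP]. }
  assert (R1 : q 0 + m0 * J 0 <= q x + m0 * J x).
  { assert (H := derive_le (fun z => q z + m0 * J z) 0 0 x ltac:(lra)).
    rewrite Rmult_0_l in H. cut (0 <= q x + m0 * J x - (q 0 + m0 * J 0)); [lra|].
    apply H; [|intros y Hy; apply Cq; lra].
    intros y Hy. eexists; split; [apply Dq; lra|].
    assert (Gy := gp y ltac:(lra)). assert (Py := pos y ltac:(lra)).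
    replace (- Derive F y / (F c + v - F y) + m0 * (g y / (F c + v - F y)))
      with ((m0 - Derive F y / g y) * (g y / (F c + v - F y))) by (field; lra).
    apply sgn; [exact Py|]. apply Rmult_le_pos; [|lra].
    assert (M := HH2 y x ltac:(lra) ltac:(lra) ltac:(lra)). unfold m0; lra. }
  assert (R2 : q c + m0 * J c <= q x + m0 * J x).
  { assert (H := derive_le (fun z => - (q z + m0 * J z)) 0 x c ltac:(lra)).
    rewrite Rmult_0_l in H. cut (0 <= - (q c + m0 * J c) - - (q x + m0 * J x)); [lra|].
    apply H; [|intros y Hy; apply (continuous_opp (fun z => q z + m0 * J z)), Cq; lra].
    intros y Hy. eexists; split; [apply (is_derive_opp (fun z => q z + m0 * J z)), Dq; lra|].
    assert (Gy := gp y ltac:(lra)). assert (Py := pos y ltac:(lra)).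
    unfold opp; simpl.
    replace (- (- Derive F y / (F c + v - F y) + m0 * (g y / (F c + v - F y))))
      with ((Derive F y / g y - m0) * (g y / (F c + v - F y))) by (field; lra).
    apply sgn; [exact Py|]. apply Rmult_le_pos; [|lra].
    assert (M := HH2 x y ltac:(lra) ltac:(lra) ltac:(lra)). unfold m0; lra. }
  assert (DFn : forall y, Derive F y = Derive F (- y)).
  { intros y. rewrite Derive_odd_fun; [reflexivity|apply HH|].
    intros z; eexists; apply (H1_derive F g a), HH. }
  assert (gn : forall y, g y = - g (- y)).
  { intros y. rewrite <- (Ropp_involutive y) at 1. apply HH. }
  assert (L1 : q xi - m1 * J xi <= q 0 - m1 * J 0).
  { assert (H := derive_le (fun z => q z + - m1 * J z) 0 xi 0 ltac:(lra)).
    rewrite Rmult_0_l in H. cut (0 <= q 0 + - m1 * J 0 - (q xi + - m1 * J xi)); [lra|].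
    apply H; [|intros y Hy; apply Cq; lra].
    intros y Hy. eexists; split; [apply Dq; lra|].
    assert (Gy := gp (- y) ltac:(lra)). assert (Py := pos y ltac:(lra)).
    rewrite (DFn y), (gn y).
    replace (- Derive F (- y) / (F c + v - F y) + - m1 * (- g (- y) / (F c + v - F y)))
      with ((m1 - Derive F (- y) / g (- y)) * (g (- y) / (F c + v - F y))) by (field; lra).
    apply sgn; [exact Py|]. apply Rmult_le_pos; [|lra].
    assert (M := HH2 (- y) (- xi) ltac:(lra) ltac:(lra) ltac:(lra)). unfold m1; lra. }
  assert (L2 : q xi - m1 * J xi <= q (- a) - m1 * J (- a)).
  { assert (H := derive_le (fun z => - (q z + - m1 * J z)) 0 (- a) xi ltac:(lra)).
    rewrite Rmult_0_l in H. cut (0 <= - (q xi + - m1 * J xi) - - (q (- a) + - m1 * J (- a))); [lra|].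
    apply H; [|intros y Hy; apply (continuous_opp (fun z => q z + - m1 * J z)), Cq; lra].
    intros y Hy. eexists; split; [apply (is_derive_opp (fun z => q z + - m1 * J z)), Dq; lra|].
    assert (Gy := gp (- y) ltac:(lra)). assert (Py := pos y ltac:(lra)).
    unfold opp; simpl. rewrite (DFn y), (gn y).
    replace (- (- Derive F (- y) / (F c + v - F y) + - m1 * (- g (- y) / (F c + v - F y))))
      with ((Derive F (- y) / g (- y) - m1) * (g (- y) / (F c + v - F y))) by (field; lra).
    apply sgn; [exact Py|]. apply Rmult_le_pos; [|lra].
    assert (M := HH2 (- xi) (- y) ltac:(lra) ltac:(lra) ltac:(lra)). unfold m1; lra. }
  assert (qE : q (- a) = q c) by (unfold q; now rewrite Ec).
  assert (J1 : 0 < J x) by (rewrite <- E0; apply (potential_increasing F g a); assumption || lra).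
  assert (J2 : J x < J c) by (apply (potential_increasing F g a); assumption || lra).
  rewrite HJ, E0 in *. rewrite HT, qE in L2.
  (* The two branches, as graphs over J, share the chord from 0 to J c. Weighting the end
     inequalities by J c - J x and J x cancels the slopes and places q xi below the chord and q x
     above it. *)
  assert (Hq : q xi <= q x).
  { assert (A1 : (J c - J x) * (q xi - m1 * J x) <= (J c - J x) * (q 0 - m1 * 0))
      by (apply Rmult_le_compat_l; lra).
    assert (A2 : J x * (q xi - m1 * J x) <= J x * (q c - m1 * J c))
      by (apply Rmult_le_compat_l; lra).
    assert (A3 : (J c - J x) * (q 0 + m0 * 0) <= (J c - J x) * (q x + m0 * J x))
      by (apply Rmult_le_compat_l; lra).
    assert (A4 : J x * (q c + m0 * J c) <= J x * (q x + m0 * J x))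
      by (apply Rmult_le_compat_l; lra).
    apply (Rmult_le_reg_l (J c)); [lra|]. lra. }
  apply Rnot_lt_le. intros Hlt.
  assert (q x < q xi); [|lra].
  unfold q. assert (Px := pos x ltac:(lra)). apply ln_increasing; lra.
Qed.

(** * Comparison of orbits with a reflected curve *)

Lemma lienard_continuous (mu : R) (F g x y : R -> R) (t : R) :
  lienard_solution mu F g x y -> continuous x t /\ continuous y t.
Proof.
  intros Hs. destruct (Hs t) as [Hx Hy]. split.
  - apply (ex_derive_continuous x). eexists; exact Hx.
  - apply (ex_derive_continuous y). eexists; exact Hy.
Qed.

(* The curve [(X s, F c + W s)] climbs from [x = -a] to [x = 0] at least as fast
   as the orbits do.  Matching points of equal potential reflects it to a curve
   over [0, c] which the orbits cannot cross downwards. *)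
Lemma reflected_barrier (F g : R -> R) (a c mu v0 : R) (x y : R -> R) (t0 : R)
  (X W S : R -> R) (s0 s1 w0 w1 r0 : R) :
  H1 F g a -> H2 F g c -> 0 < c -> F c = F (- a) -> 0 < v0 ->
  Iint F g c v0 (- a) c = 0 -> 0 < mu ->
  lienard_solution mu F g x y -> (forall t, x t <= c) -> x t0 = 0 ->
  w1 <= y t0 / mu - F c -> w1 <= v0 -> 0 < w0 -> 0 < r0 ->
  s0 < s1 -> (forall s, s0 <= s <= s1 -> continuous X s) -> X s0 = - a -> X s1 = 0 ->
  (forall s, s0 < s < s1 ->
     - a < X s < 0 /\ w0 <= W s <= w1 /\ r0 <= S s <= F c + W s - F (X s) /\
     exists dX, 0 < dX /\ is_derive X s dX /\
       is_derive W s (- g (X s) * dX / (mu ^ 2 * S s))) ->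
  False.
Proof.
  intros HH HH2 Hc Ec Hv0 HI Hmu Hsol Hxc Ht0 Hw1 Hw1v Hw0 Hr0 Hs01 CX HX0 HX1 HL.
  assert (Ha : 0 < a) by apply HH.
  assert (Hac := H1_a_lt_c F g a c HH Hc Ec).
  assert (E0 := potential_0 F g c v0).
  assert (HT := potential_balance F g a c v0 HH HH2 Hc Ec Hv0 HI).
  assert (gp : forall z, 0 < z -> 0 < g z) by apply HH.
  assert (F0 := odd_fun_0 F (proj1 HH)).
  assert (Fcpos : 0 < F c).
  { assert (H := H1_decreasing F g a (- a) 0 HH). lra. }
  set (J := potential F g c v0) in *.
  (* J (X s) decreases from J (-a) = J c to 0, so every point z of (0, c) has a matching parameter r
     (J z). The reflected curve has height W (r (J z)) over z. *)
  destruct (decreasing_inverse (fun s => J (X s)) s0 s1 Hs01) as [r Hr].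
  { intros s Hs. apply (continuous_comp X J); [apply CX, Hs|].
    apply (continuous_potential F g a); assumption. }
  { intros p q Hp Hpq Hq.
    assert (Xpq : X p < X q).
    { apply derive_lt; [assumption| |].
      - intros z Hz. destruct (HL z) as (_ & _ & _ & dX & HdX & HdX' & _); [lra|].
        now exists dX.
      - intros z Hz. apply CX; lra. }
    apply (potential_decreasing F g a); try assumption.
    destruct (Req_dec q s1) as [->|]; [lra|].
    destruct (HL q) as (HXq & _); lra. }
  rewrite HX0, HX1, HT, E0 in Hr.
  pose (v t := y t / mu - F c).
  assert (Dv : forall t, is_derive v t (- g (x t) / mu)).
  { intros t. unfold v. destruct (Hsol t) as [_ Hy].
    evar_last.
    - apply (is_derive_minus (fun t => y t / mu) (fun _ => F c)).
      + apply (is_derive_ext (fun t => scal (/ mu) (y t))).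
        * intros z. apply Rmult_comm.
        * apply (is_derive_scal y), Hy.
      + apply is_derive_const.
    - unfold minus, plus, opp, zero, scal, mult; simpl. unfold mult; simpl.
      field. lra. }
  assert (Dx : forall t, is_derive x t (mu * (v t + F c - F (x t)))).
  { intros t. destruct (Hsol t) as [Hx _]. evar_last; [exact Hx|].
    unfold v. field. lra. }
  assert (Cx : forall t, continuous x t) by (intros t; exact (proj1 (lienard_continuous mu F g x y t Hsol))).
  assert (Cv : forall t, continuous v t)
    by (intros t; apply (ex_derive_continuous v); eexists; apply Dv).
  assert (HJ : forall z, 0 < z < c -> 0 < J z < J c).
  { intros z Hz. split.
    - rewrite <- E0. apply (potential_increasing F g a); assumption || lra.
    - apply (potential_increasing F g a); assumption || lra. }
  destruct (continuity_ab_maj g 0 c) as [zm [Hzm _]]; [lra| |].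
  { intros z _. apply continuity_pt_filterlim, (H1_continuous F g a z HH). }
  assert (Hg0 : 0 < g zm) by (apply (Rlt_le_trans _ (g c)); [apply gp, Hc|apply Hzm; lra]).
  (* A uniform bound for the coefficient [k] below, from g <= g zm, P <= F c + v0, S >= r0 and Q >=
     v0. *)
  pose (K := g zm * (F c + v0) / (mu * r0 * v0)).
  assert (HK : 0 <= K).
  { unfold K. left. apply Rdiv_lt_0_compat; [nra|].
    repeat apply Rmult_lt_0_compat; assumption. }
  assert (w01 : w0 <= w1).
  { destruct (HL ((s0 + s1) / 2)) as (_ & H & _); lra. }
  assert (above : forall t1, t0 < t1 -> (forall t, t0 < t < t1 -> 0 < x t < c) ->
             forall t, t0 < t < t1 -> w0 <= v t).
  { intros t1 Ht1 Hin t Ht.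
    (* Height of the orbit above the reflected curve. At t0 the orbit is at x = 0, where [r] is not
       controlled; since W <= w1, the function v - w1 serves as the continuous lower bound in
       [gronwall_nonneg]. *)
    pose (D t := v t - W (r (J (x t)))).
    assert (HD : 0 <= D t).
    { apply (gronwall_nonneg D (fun s => v s - w1) K t0 t1); try assumption.
      - intros s Hs. assert (Hxs := Hin s Hs).
        destruct (Hr (J (x s)) (HJ _ Hxs)) as (Hrs & HJX & Hdr).
        set (z := r (J (x s))) in *.
        destruct (HL z Hrs) as (HXz & HWz & HSz & dX & HdX & DX & DW).
        assert (FX := F_matched_le F g a c v0 (X z) (x s) HH HH2 Hc Ec Hv0 HI HXz Hxs HJX).
        assert (FXc := F_lt_max F g a c (X z) HH HH2 Hc Ec ltac:(lra)).
        assert (Fxc := F_lt_max F g a c (x s) HH HH2 Hc Ec ltac:(lra)).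
        assert (gX := g_neg F g a (X z) HH ltac:(lra)).
        assert (gx := gp (x s) ltac:(lra)).
        assert (FX0 : 0 <= F (X z)).
        { assert (H := H1_decreasing F g a (X z) 0 HH). lra. }
        set (P := F c + v0 - F (X z)) in *. set (Q := F c + v0 - F (x s)) in *.
        assert (HP : 0 < P <= F c + v0) by (unfold P; lra).
        assert (HQ : v0 <= Q) by (unfold Q; lra).
        assert (DK : is_derive (fun s => J (X s)) z (dX * (g (X z) / P))).
        { apply (is_derive_comp J X).
          - unfold P. rewrite <- (potential_density_eq F g a) by (assumption || lra).
            apply (is_derive_potential F g a); assumption.
          - exact DX. }
        assert (Dr := Hdr _ DK).
        assert (Kne : dX * (g (X z) / P) <> 0).
        { apply Rmult_integral_contrapositive_currified; [lra|].
          unfold Rdiv. apply Rmult_integral_contrapositive_currified; [lra|].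
          apply Rinv_neq_0_compat; lra. }
        specialize (Dr Kne).
        (* Along the orbit the reflected curve falls at rate k (v + F c - F x): the chain rule
           combines W', 1 / (J o X)', J' and x', and both dX and g (X z) cancel. *)
        pose (k := g (x s) * P / (mu * S z * Q)).
        exists (- g (x s) / mu + k * (v s + F c - F (x s))). split.
        + unfold D. evar_last.
          * apply (is_derive_minus v (fun s => W (r (J (x s))))); [apply Dv|].
            apply (is_derive_comp W (fun s => r (J (x s)))); [exact DW|].
            apply (is_derive_comp r (fun s => J (x s))); [exact Dr|].
            apply (is_derive_comp J x); [|apply Dx].
            apply (is_derive_potential F g a); assumption.
          * rewrite (potential_density_eq F g a) by (assumption || lra).
            unfold minus, plus, opp, scal, mult; simpl. unfold mult; simpl.
            fold z. fold Q. unfold k. field. lra.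
        + intros Dneg.
          assert (kK : k <= K).
          { unfold k, K. apply Rmult_le_compat.
            - apply Rmult_le_pos; lra.
            - left. apply Rinv_0_lt_compat. repeat apply Rmult_lt_0_compat; lra.
            - apply Rmult_le_compat; try lra. apply Hzm; lra.
            - apply Rinv_le_contravar; [repeat apply Rmult_lt_0_compat; lra|].
              rewrite !Rmult_assoc. apply Rmult_le_compat_l; [lra|].
              apply Rmult_le_compat; lra. }
          assert (KD : K * D s <= k * D s).
          { rewrite (Rmult_comm K), (Rmult_comm k). apply Rmult_le_compat_neg_l; lra. }
          eapply Rle_trans; [exact KD|].
          (* What remains after splitting off k D is the slope comparison on the reflected curve
             itself. With d = v0 - W >= 0 and S <= P - d it reduces to P (Q - d) - (P - d) Q = d (Q
             - P) >= 0, and Q >= P is the inequality F x <= F X between matched points. *)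
          replace (v s + F c - F (x s)) with (D s + (Q - (v0 - W z)))
            by (unfold D, Q; fold z; ring).
          cut (0 <= - g (x s) / mu + k * (Q - (v0 - W z))); [lra|].
          replace (- g (x s) / mu + k * (Q - (v0 - W z)))
            with (g (x s) / (mu * S z * Q) * (P * (Q - (v0 - W z)) - S z * Q))
            by (unfold k; field; lra).
          apply Rmult_le_pos.
          * left. apply Rdiv_lt_0_compat; [exact gx|repeat apply Rmult_lt_0_compat; lra].
          * assert (S z * Q <= (P - (v0 - W z)) * Q)
              by (apply Rmult_le_compat_r; [lra|unfold P; lra]).
            assert (0 <= (v0 - W z) * (Q - P))
              by (apply Rmult_le_pos; [lra|unfold P, Q; lra]).
            lra.
      - intros s Hs. destruct (Hr (J (x s)) (HJ _ (Hin s Hs))) as (Hrs & _ & _).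
        destruct (HL _ Hrs) as (_ & HWz & _). unfold D. lra.
      - apply (continuous_minus v (fun _ => w1)); [apply Cv|apply continuous_const].
      - unfold v; lra. }
    destruct (Hr (J (x t)) (HJ _ (Hin t Ht))) as (Hrs & _ & _).
    destruct (HL _ Hrs) as (_ & HWz & _). unfold D in HD. lra. }
  assert (speed : forall t1, t0 < t1 -> (forall t, t0 < t < t1 -> 0 < x t < c) ->
             mu * w0 * (t1 - t0) <= x t1).
  { intros t1 Ht1 Hin. replace (x t1) with (x t1 - x t0) by lra.
    apply derive_le; [lra| |intros; apply Cx].
    intros t Ht. eexists; split; [apply Dx|].
    apply Rmult_le_compat_l; [lra|].
    assert (H := above t1 Ht1 Hin t Ht).
    assert (H' := Hin t Ht).
    assert (H'' := F_lt_max F g a c (x t) HH HH2 Hc Ec ltac:(lra)). lra. }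
  destruct (derive_pos_local x t0 _ (Dx t0)) as (e & He & Hinc & _).
  { apply Rmult_lt_0_compat; [assumption|]. rewrite Ht0. unfold v. lra. }
  destruct (continuous_eps x t0 (Cx t0) c Hc) as [d [Hd Hd']].
  pose (ta := t0 + Rmin e d / 2).
  assert (Hm : 0 < Rmin e d) by (apply Rmin_glb_lt; assumption).
  assert (Hme := Rmin_l e d). assert (Hmd := Rmin_r e d).
  assert (Hstart : forall t, t0 < t <= ta -> 0 < x t < c).
  { intros t Ht. unfold ta in Ht. split.
    - rewrite <- Ht0. apply Hinc. lra.
    - assert (H : Rabs (x t - x t0) < c) by (apply Hd'; rewrite Rabs_right; lra).
      apply Rabs_def2 in H. lra. }
  (* At horizontal speed at least mu w0, staying in (0, c) until [te] would carry the orbit a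
     distance of at least 2 c. *)
  pose (te := ta + 2 * c / (mu * w0)).
  assert (Hmw : 0 < mu * w0) by (apply Rmult_lt_0_compat; assumption).
  assert (Htae : ta < te).
  { unfold te. assert (0 < 2 * c / (mu * w0)) by (apply Rdiv_lt_0_compat; lra). lra. }
  assert (Hta0 : t0 < ta) by (unfold ta; lra).
  destruct (classic (forall t, t0 < t < te -> 0 < x t < c)) as [Hin|Hout].
  - assert (H := speed te ltac:(lra) Hin). assert (H' := Hxc te).
    assert (2 * c <= mu * w0 * (te - t0)).
    { replace (2 * c) with (mu * w0 * (2 * c / (mu * w0))) by (field; lra).
      apply Rmult_le_compat_l; [lra|]. unfold te. lra. }
    lra.
  - apply not_all_ex_not in Hout. destruct Hout as [tb Hout].
    apply imply_to_and in Hout. destruct Hout as [Htb Hout].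
    assert (Htab : ta < tb).
    { apply Rnot_le_lt. intros Hle. apply Hout, Hstart. lra. }
    assert (Hprod : 0 <= - (x tb * (c - x tb))).
    { assert (H := Hxc tb). destruct (Rlt_dec 0 (x tb)); [|].
      2:{ assert (0 <= - x tb * (c - x tb)) by (apply Rmult_le_pos; lra). lra. }
      replace (x tb) with c by (apply NNPP; intros H'; apply Hout; lra). lra. }
    (* -x (c - x) is negative exactly while 0 < x < c, so its first zero is the first exit time from
       (0, c). By [speed] x is positive then, hence the exit is at x = c. *)
    destruct (first_zero (fun t => - (x t * (c - x t))) ta tb Htab) as (t1 & Ht1 & Hz & Hlt).
    + intros t _. apply (continuous_opp (fun t => x t * (c - x t))).
      apply (continuous_mult x (fun t => c - x t)); [apply Cx|].
      apply (continuous_minus (fun _ => c) x); [apply continuous_const|apply Cx].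
    + assert (H := Hstart ta ltac:(lra)).
      assert (0 < x ta * (c - x ta)) by (apply Rmult_lt_0_compat; lra). lra.
    + exact Hprod.
    + assert (Hin : forall t, t0 < t < t1 -> 0 < x t < c).
      { intros t Ht. destruct (Rle_dec t ta); [apply Hstart; lra|].
        assert (H := Hlt t ltac:(lra)). assert (H' := Hxc t). split.
        - apply Rnot_le_lt. intros Hle.
          assert (0 <= - x t * (c - x t)) by (apply Rmult_le_pos; lra). lra.
        - destruct H' as [|E1]; [assumption|]. rewrite E1 in H. lra. }
      assert (Hx1 := speed t1 ltac:(lra) Hin).
      assert (0 < mu * w0 * (t1 - t0)) by (apply Rmult_lt_0_compat; lra).
      assert (Ex1 : x t1 = c).
      { destruct (Rmult_integral (x t1) (c - x t1)); lra. }
      assert (Hv1 : w0 <= v t1).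
      { apply Rnot_lt_le. intros Hlt1.
        destruct (continuous_eps v t1 (Cv t1) (w0 - v t1)) as [d1 [Hd1 Hd1']]; [lra|].
        pose (tt := Rmax ((t0 + t1) / 2) (t1 - d1 / 2)).
        assert (tt < t1) by (unfold tt; apply Rmax_lub_lt; lra).
        assert ((t0 + t1) / 2 <= tt) by apply Rmax_l.
        assert (t1 - d1 / 2 <= tt) by apply Rmax_r.
        assert (HA := above t1 ltac:(lra) Hin tt ltac:(lra)).
        assert (HB : Rabs (v tt - v t1) < w0 - v t1) by (apply Hd1'; rewrite Rabs_left; lra).
        apply Rabs_def2 in HB. lra. }
      (* At x = c the horizontal speed is mu v >= mu w0 > 0, so the orbit goes beyond c, against
         [Hxc]. *)
      destruct (derive_pos_local x t1 _ (Dx t1)) as (e1 & He1 & Hinc1 & _).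
      { apply Rmult_lt_0_compat; [assumption|]. rewrite Ex1. lra. }
      assert (H' := Hinc1 (t1 + e1 / 2) ltac:(lra)). assert (H'' := Hxc (t1 + e1 / 2)). lra.
Qed.

(** * Periodic orbits *)

(** A nondecreasing function with equal values at t0 and t0 + T is constant in between, so it has no
    positive slope at t0. It is applied to the energy along a periodic orbit. *)
Lemma increasing_not_periodic (V : R -> R) (t0 T : R) :
  0 < T -> V (t0 + T) = V t0 ->
  (forall t, exists d, is_derive V t d /\ 0 <= d) ->
  forall d, is_derive V t0 d -> d <= 0.
Proof.
  intros HT HV HD d Hd. apply Rnot_lt_le. intros Hpos.
  assert (mono : forall p q, p <= q -> V p <= V q).
  { intros p q Hpq. assert (H := derive_le V 0 p q Hpq). rewrite Rmult_0_l in H.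
    cut (0 <= V q - V p); [lra|]. apply H; [intros; apply HD|].
    intros t _. destruct (HD t) as [d' [Hd' _]].
    apply (ex_derive_continuous V). now exists d'. }
  destruct (derive_pos_local V t0 d Hd Hpos) as (e & He & Hinc & _).
  assert (Hm : 0 < Rmin e T) by (apply Rmin_glb_lt; assumption).
  assert (Hme := Rmin_l e T). assert (HmT := Rmin_r e T).
  assert (A := Hinc (t0 + Rmin e T / 2) ltac:(lra)).
  assert (B := mono (t0 + Rmin e T / 2) (t0 + T) ltac:(lra)). lra.
Qed.

(* Inside the strip |x| <= a the energy [y^2/2 + G x] increases along orbits. *)
Lemma periodic_leaves_strip (F g : R -> R) (a mu T : R) (x y : R -> R) :
  H1 F g a -> 0 < mu -> lienard_solution mu F g x y ->
  0 < T -> (forall t, x (t + T) = x t /\ y (t + T) = y t) ->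
  (exists t1 t2, (x t1, y t1) <> (x t2, y t2)) ->
  exists t, a < Rabs (x t).
Proof.
  intros HH Hmu Hsol HT Hper [t1 [t2 Hne]].
  apply NNPP. intros Hno.
  assert (Hin : forall t, - a <= x t <= a).
  { intros t. apply Rabs_le_between, Rnot_lt_le. intros Ht. apply Hno. now exists t. }
  assert (F0 := odd_fun_0 F (proj1 HH)).
  assert (gp : forall z, 0 < z -> 0 < g z) by apply HH.
  pose (G z := RInt g 0 z).
  assert (DG : forall z, is_derive G z (g z)).
  { intros z. apply (is_derive_RInt g G 0); [|apply (H1_continuous F g a z HH)].
    apply filter_forall. intros w. apply (RInt_correct (V := R_CompleteNormedModule)).
    apply (ex_RInt_continuous (V := R_CompleteNormedModule)).
    intros u _. apply (H1_continuous F g a u HH). }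
  pose (V t := y t * y t / 2 + G (x t)).
  assert (DV : forall t, is_derive V t (- mu * (g (x t) * F (x t)))).
  { intros t. destruct (Hsol t) as [Hx Hy].
    unfold V. evar_last.
    - apply (is_derive_plus (fun t => y t * y t / 2) (fun t => G (x t))).
      + apply (is_derive_ext (fun t => scal (/ 2) (y t * y t))).
        * intros s. apply Rmult_comm.
        * apply (is_derive_scal (fun t => y t * y t)).
          apply (is_derive_mult y y); [exact Hy|exact Hy|intros; apply Rmult_comm].
      + apply (is_derive_comp G x); [apply DG|exact Hx].
    - unfold plus, scal, mult; simpl. unfold mult; simpl. field. }
  assert (sgn : forall z, - a <= z <= a -> z <> 0 -> g z * F z < 0).
  { intros z Hz Hz0. destruct (Rlt_dec 0 z) as [Hp|Hn].
    - assert (A := gp z Hp). assert (B := H1_decreasing F g a 0 z HH). nra.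
    - assert (A := g_neg F g a z HH). assert (B := H1_decreasing F g a z 0 HH). nra. }
  (* In the strip the energy has derivative -mu g F >= 0, positive unless x = 0; periodicity then
     forces x = 0 at all times. The first equation gives y = 0, so the orbit would be the
     equilibrium. *)
  assert (Hx0 : forall t, x t = 0).
  { intros t. apply NNPP. intros Hxt.
    assert (H := sgn _ (Hin t) Hxt).
    assert (- mu * (g (x t) * F (x t)) <= 0); [|nra].
    apply (increasing_not_periodic V t T); [exact HT| | |apply DV].
    - unfold V. destruct (Hper t) as [-> ->]. reflexivity.
    - intros s. eexists; split; [apply DV|].
      destruct (Req_dec (x s) 0) as [E|E].
      + rewrite E, F0. lra.
      + assert (H' := sgn _ (Hin s) E). nra. }
  assert (Hy0 : forall t, y t = 0).
  { intros t. destruct (Hsol t) as [Hx _].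
    assert (H : is_derive x t 0).
    { apply (is_derive_ext (fun _ => 0)); [intros; now rewrite Hx0|apply (is_derive_const 0)]. }
    apply is_derive_unique in H. apply is_derive_unique in Hx.
    rewrite H, Hx0, F0 in Hx. lra. }
  apply Hne. now rewrite !Hx0, !Hy0.
Qed.

(** While x < 0, y strictly increases, so a periodic orbit must come back to x = 0, first at t0. At
    its first arrival tb at x = -a it lies strictly above the graph of mu F. At the last such
    arrival ta before t0 it is at least as high, and from ta on it stays in (-a, 0). *)
Lemma left_passage (F g : R -> R) (a mu T : R) (x y : R -> R) (tm : R) :
  H1 F g a -> 0 < mu -> lienard_solution mu F g x y ->
  0 < T -> (forall t, x (t + T) = x t /\ y (t + T) = y t) ->
  x tm < - a ->
  exists ta t0, ta < t0 /\ x ta = - a /\ x t0 = 0 /\ mu * F (- a) < y ta /\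
    forall t, ta < t < t0 -> - a < x t < 0.
Proof.
  intros HH Hmu Hsol HT Hper Htm.
  assert (Ha : 0 < a) by apply HH.
  assert (Cx : forall t, continuous x t)
    by (intros t; exact (proj1 (lienard_continuous mu F g x y t Hsol))).
  assert (Cy : forall t, continuous y t)
    by (intros t; exact (proj2 (lienard_continuous mu F g x y t Hsol))).
  assert (Ycr : forall p q, p < q -> (forall t, p < t < q -> x t < 0) -> y p < y q).
  { intros p q Hpq Hneg. apply derive_lt; [assumption| |intros; apply Cy].
    intros t Ht. destruct (Hsol t) as [_ Hy]. eexists; split; [exact Hy|].
    assert (H := g_neg F g a (x t) HH (Hneg t Ht)). lra. }
  destruct (classic (exists t, tm < t /\ 0 <= x t)) as [[tp [Htp Hxp]]|Hno].
  2:{ exfalso. assert (y tm < y (tm + T)).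
      { apply Ycr; [lra|]. intros t Ht. apply Rnot_le_lt. intros Hle.
        apply Hno. exists t; split; [lra|exact Hle]. }
      destruct (Hper tm) as [_ E]. lra. }
  destruct (first_zero x tm tp Htp) as (t0 & Ht0 & Hx0 & Hneg); try lra.
  { intros; apply Cx. }
  assert (Cxa : forall t, continuous (fun t => x t + a) t).
  { intros t. apply (continuous_plus x (fun _ => a)); [apply Cx|apply continuous_const]. }
  destruct (first_zero (fun t => x t + a) tm t0) as (tb & Htb & Hxb & Hnegb); try lra.
  { intros; apply Cxa. }
  assert (Htb0 : tb < t0) by (destruct (Req_dec tb t0) as [->|]; lra).
  assert (Ex : x tb = - a) by lra.
  destruct (Hsol tb) as [Hxtb Hytb].
  (* the tangency y = mu F at x = -a would be a strict minimum of x *)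
  assert (Hvb : mu * F (- a) < y tb).
  { rewrite Ex in Hxtb, Hytb.
    destruct (Rtotal_order (y tb) (mu * F (- a))) as [Hlt|[Heq|Hgt]]; [exfalso|exfalso|exact Hgt].
    - destruct (derive_pos_local (fun t => - x t) tb _ (is_derive_opp x tb _ Hxtb))
        as (e & He & _ & Hdec); [unfold opp; simpl; lra|].
      assert (Hm : 0 < Rmin e (tb - tm)) by (apply Rmin_glb_lt; lra).
      assert (Hme := Rmin_l e (tb - tm)). assert (HmT := Rmin_r e (tb - tm)).
      assert (A := Hdec (tb - Rmin e (tb - tm) / 2) ltac:(lra)).
      assert (B := Hnegb (tb - Rmin e (tb - tm) / 2) ltac:(lra)). lra.
    - assert (DD : is_derive (fun t => y t - mu * F (x t)) tb (- g (- a))).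
      { evar_last.
        - apply (is_derive_minus y (fun t => mu * F (x t))); [exact Hytb|].
          apply (is_derive_scal (fun t => F (x t))).
          apply (is_derive_comp F x); [apply (H1_derive F g a), HH|exact Hxtb].
        - unfold minus, plus, opp, scal, mult; simpl. unfold mult; simpl.
          rewrite Heq. ring. }
      destruct (derive_pos_local _ tb _ DD) as (e & He & _ & Hdec).
      { assert (H := g_neg F g a (- a) HH ltac:(lra)). lra. }
      rewrite Ex, Heq in Hdec.
      assert (Hm : 0 < Rmin e (tb - tm)) by (apply Rmin_glb_lt; lra).
      assert (Hme := Rmin_l e (tb - tm)). assert (HmT := Rmin_r e (tb - tm)).
      set (s := tb - Rmin e (tb - tm) / 2).
      assert (A : - x s < - x tb).
      { apply (derive_lt (fun t => - x t)); [unfold s; lra| |].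
        - intros t Ht. destruct (Hsol t) as [Hxt _].
          eexists; split; [apply (is_derive_opp x), Hxt|].
          assert (H := Hdec t ltac:(unfold s in Ht; lra)). unfold opp; simpl. lra.
        - intros t _. apply (continuous_opp x), Cx. }
      assert (B := Hnegb s ltac:(unfold s; lra)). lra. }
  destruct (last_zero (fun t => - (x t + a)) tb t0 Htb0) as (ta & Hta & Hxa & Hpos); try lra.
  { intros t _. apply (continuous_opp (fun t => x t + a)), Cxa. }
  exists ta, t0. repeat split; try lra.
  - destruct (Req_dec ta tb) as [->|Hn]; [exact Hvb|].
    assert (H := Ycr tb ta ltac:(lra) ltac:(intros; apply Hneg; lra)). lra.
  - assert (H' := Hpos t ltac:(lra)). lra.
  - apply Hneg; lra.
Qed.

Lemma lienard_flip (F g : R -> R) (mu : R) (x y : R -> R) :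
  odd_fun F -> odd_fun g -> lienard_solution mu F g x y ->
  lienard_solution mu F g (fun t => - x t) (fun t => - y t).
Proof.
  intros oF og Hs t. destruct (Hs t) as [Hx Hy]. rewrite oF, og. split.
  - evar_last; [apply (is_derive_opp x), Hx|]. unfold opp; simpl. ring.
  - evar_last; [apply (is_derive_opp y), Hy|]. reflexivity.
Qed.

(** * The upper solution given by (H3) *)

Lemma rpow_pos (x p : R) : 0 < x -> rpow x p = exp (p * ln x).
Proof. intros Hx. unfold rpow. destruct (Rlt_dec 0 x); [reflexivity|lra]. Qed.

Lemma rpow_nonneg (x p : R) : 0 <= rpow x p.
Proof. unfold rpow. destruct (Rlt_dec 0 x); [left; apply exp_pos|lra]. Qed.

Lemma continuous_rpow (p x : R) : 0 < p -> continuous (fun y => rpow y p) x.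
Proof.
  intros Hp. destruct (Rtotal_order x 0) as [Hx|[->|Hx]].
  - apply (continuous_ext_loc _ (fun _ => 0) x); [|apply continuous_const].
    exists (mkposreal (- x) ltac:(lra)). intros y Hy.
    apply Rabs_def2 in Hy. simpl in Hy. unfold minus, plus, opp in Hy; simpl in Hy.
    unfold rpow. destruct (Rlt_dec 0 y); [lra|reflexivity].
  - apply filterlim_locally. intros e.
    (* The radius is e^(1/p). *)
    exists (mkposreal (exp (ln e / p)) (exp_pos _)). intros y Hy.
    apply Rabs_def2 in Hy. simpl in Hy. unfold minus, plus, opp in Hy; simpl in Hy.
    assert (E0 : rpow 0 p = 0) by (unfold rpow; destruct (Rlt_dec 0 0); lra).
    rewrite E0. unfold ball; simpl. unfold AbsRing_ball, abs, minus, plus, opp; simpl.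
    assert (He := cond_pos e).
    rewrite Ropp_0, Rplus_0_r, Rabs_right by (apply Rle_ge, rpow_nonneg).
    destruct (Rlt_dec 0 y) as [Hy0|Hy0].
    + rewrite rpow_pos by assumption.
      rewrite <- (exp_ln e) by assumption. apply exp_increasing.
      assert (H : ln y < ln e / p).
      { rewrite <- (ln_exp (ln e / p)). apply ln_increasing; lra. }
      apply (Rmult_lt_compat_l p) in H; [|assumption].
      replace (p * (ln e / p)) with (ln e) in H by (field; lra). exact H.
    + unfold rpow. destruct (Rlt_dec 0 y); lra.
  - apply (continuous_ext_loc _ (fun y => exp (p * ln y)) x).
    + exists (mkposreal x Hx). intros y Hy.
      apply Rabs_def2 in Hy. simpl in Hy. unfold minus, plus, opp in Hy; simpl in Hy.
      rewrite rpow_pos; [reflexivity|lra].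
    + apply (ex_derive_continuous (fun y => exp (p * ln y))). auto_derive. lra.
Qed.

(** The integrand of the improper integral in [kappa]. Since [rpow] vanishes for s <= 0, it equals 1
    there and is continuous on the whole line. *)
Definition kernel (l s : R) : R := 1 / (rpow s l + 1).

Lemma continuous_kernel (l s : R) : 0 < l -> continuous (kernel l) s.
Proof.
  intros Hl. unfold kernel.
  apply (continuous_mult (fun _ => 1) (fun s => / (rpow s l + 1))); [apply continuous_const|].
  apply (continuous_comp (fun s => rpow s l + 1) Rinv).
  - apply (continuous_plus (fun s => rpow s l) (fun _ => 1));
      [apply continuous_rpow, Hl|apply continuous_const].
  - apply continuous_Rinv. assert (H := rpow_nonneg s l). lra.
Qed.

Lemma is_RInt_kernel (l p q : R) :
  0 < l -> is_RInt (kernel l) p q (RInt (kernel l) p q).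
Proof.
  intros Hl. apply (RInt_correct (V := R_CompleteNormedModule)).
  apply (ex_RInt_continuous (V := R_CompleteNormedModule)).
  intros; apply continuous_kernel, Hl.
Qed.

Lemma is_derive_kernel_primitive (l x : R) :
  0 < l -> is_derive (RInt (kernel l) 0) x (kernel l x).
Proof.
  intros Hl. apply (is_derive_RInt _ _ 0); [|apply continuous_kernel, Hl].
  apply filter_forall. intros y. apply is_RInt_kernel, Hl.
Qed.

Lemma kernel_pos (l s : R) : 0 < kernel l s <= 1.
Proof.
  unfold kernel. assert (H := rpow_nonneg s l). split.
  - apply Rdiv_lt_0_compat; lra.
  - apply (Rmult_le_reg_r (rpow s l + 1)); [lra|]. field_simplify; lra.
Qed.

Lemma kernel_primitive_incr (l x y : R) :
  0 < l -> x < y -> RInt (kernel l) 0 x < RInt (kernel l) 0 y.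
Proof.
  intros Hl Hxy. apply derive_lt; [assumption| |].
  - intros z _. eexists; split; [apply is_derive_kernel_primitive, Hl|apply kernel_pos].
  - intros z _. apply (ex_derive_continuous (RInt (kernel l) 0)).
    eexists; apply is_derive_kernel_primitive, Hl.
Qed.

(** The kernel is at most 1 on [0, 1] and at most s^(-l) beyond, whose integral over [1, x] is below
    1 / (l - 1). *)
Lemma kernel_primitive_bounded (l x : R) :
  1 < l -> 1 <= x -> RInt (kernel l) 0 x <= 1 + 1 / (l - 1).
Proof.
  intros Hl Hx. set (N := RInt (kernel l) 0).
  assert (DN : forall z, is_derive N z (kernel l z))
    by (intros z; apply is_derive_kernel_primitive; lra).
  assert (CN : forall z, continuous N z)
    by (intros z; apply (ex_derive_continuous N); eexists; apply DN).
  assert (N0 : N 0 = 0) by apply (RInt_point (V := R_CompleteNormedModule)).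
  assert (A : N 1 <= 1).
  { assert (H := derive_le (fun z => - N z) (-1) 0 1 ltac:(lra)).
    cut (-1 * (1 - 0) <= - N 1 - - N 0); [lra|]. apply H.
    - intros z _. eexists; split; [apply (is_derive_opp N), DN|].
      assert (K := kernel_pos l z). unfold opp; simpl. lra.
    - intros z _. apply (continuous_opp N), CN. }
  (* A primitive of z^(-l) minus the primitive of the kernel, hence nondecreasing on [1, x]. *)
  set (B z := - / (l - 1) * exp ((1 - l) * ln z) - N z).
  assert (DB : forall z, 0 < z -> is_derive B z (exp (- l * ln z) - kernel l z)).
  { intros z Hz. unfold B. apply (is_derive_minus (fun z => - / (l - 1) * exp ((1 - l) * ln z)) N);
      [|apply DN].
    auto_derive; [exact Hz|].
    replace ((1 - l) * ln z) with (- l * ln z + ln z) by ring.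
    rewrite exp_plus, exp_ln by exact Hz. field. lra. }
  assert (Bmon : 0 <= B x - B 1).
  { assert (H := derive_le B 0 1 x Hx). rewrite Rmult_0_l in H. apply H.
    - intros z Hz. eexists; split; [apply DB; lra|].
      unfold kernel. rewrite rpow_pos by lra.
      assert (Hp := exp_pos (l * ln z)).
      replace (- l * ln z) with (- (l * ln z)) by ring. rewrite exp_Ropp.
      assert (1 / (exp (l * ln z) + 1) <= / exp (l * ln z)); [|lra].
      unfold Rdiv. rewrite Rmult_1_l. apply Rinv_le_contravar; lra.
    - intros z Hz. apply (ex_derive_continuous B). eexists; apply DB; lra. }
  unfold B in Bmon. rewrite ln_1, Rmult_0_r, exp_0 in Bmon.
  assert (Hp := exp_pos ((1 - l) * ln x)).
  assert (0 < / (l - 1)) by (apply Rinv_0_lt_compat; lra).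
  assert (0 < / (l - 1) * exp ((1 - l) * ln x)) by (apply Rmult_lt_0_compat; assumption).
  unfold Rdiv. lra.
Qed.

(** [RInt_gen] is a total function, so convergence has to be established: the primitive is
    increasing and bounded, and its supremum is the improper integral. *)
Lemma kernel_primitive_le_improper (l x : R) :
  1 < l ->
  RInt (kernel l) 0 x <= RInt_gen (kernel l) (at_point 0) (Rbar_locally p_infty).
Proof.
  intros Hl. set (N := RInt (kernel l) 0).
  destruct (completeness (fun r => exists z, r = N z)) as [I [HI1 HI2]].
  - exists (1 + 1 / (l - 1)). intros r [z ->].
    apply Rle_trans with (N (Rmax 1 z)); [|apply kernel_primitive_bounded; [lra|apply Rmax_l]].
    destruct (Rmax_r 1 z) as [Hz|<-]; [|lra].
    left; apply kernel_primitive_incr; lra.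
  - exists (N 0). now exists 0.
  - assert (HIg : is_RInt_gen (kernel l) (at_point 0) (Rbar_locally p_infty) I).
    { intros P [e HP].
      assert (Hz : exists z, I - e < N z).
      { assert (He := cond_pos e). apply NNPP. intros Hno. assert (I <= I - e); [|lra].
        apply HI2. intros r [z ->]. apply Rnot_lt_le. intros Hlt. apply Hno. now exists z. }
      destruct Hz as [z Hz].
      apply (Filter_prod _ _ _ (fun p => p = 0) (fun q => z < q)).
      - reflexivity.
      - now exists z.
      - intros p q -> Hq. exists (N q). split; [apply is_RInt_kernel; lra|].
        apply HP. assert (H := kernel_primitive_incr l z q ltac:(lra) Hq).
        assert (H' : N q <= I) by (apply HI1; now exists q).
        fold N in H. apply Rabs_def1; unfold minus, plus, opp; simpl;
          assert (He := cond_pos e); lra. }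
    rewrite (is_RInt_gen_unique (V := R_CompleteNormedModule) _ _ HIg).
    apply HI1. now exists x.
Qed.

(* [delta] minimises [delta + A r / (mu^2 delta)], the height reached at x = 0 by
   a curve starting at height [delta] over x = -a. *)
Lemma kappa_optimal (M L l mu A : R) :
  1 < l -> 0 < L -> 0 < mu -> 0 < A ->
  A = M * RInt_gen (kernel l) (at_point 0) (Rbar_locally p_infty) ->
  exists delta, 0 < delta /\
    delta + A * exp (ln (delta / L) / l) / (mu ^ 2 * delta)
      = kappa M L l * rpow (1 / mu) (2 * l / (2 * l - 1)).
Proof.
  intros Hl HL Hmu HA EA.
  set (lam := ln (l / (l - 1))).
  (* The logarithm of the minimiser. A vanishing derivative in delta means delta^(2 - 1/l) = ((l -
     1) / l) A / (mu^2 L^(1/l)). *)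
  set (ld := - lam * l / (2 * l - 1) + l / (2 * l - 1) * ln A
             - ln L / (2 * l - 1) - 2 * l / (2 * l - 1) * ln mu).
  assert (Hll : 0 < l / (l - 1)) by (apply Rdiv_lt_0_compat; lra).
  assert (HiL : 0 < 1 / L) by (apply Rdiv_lt_0_compat; lra).
  assert (Himu : 0 < 1 / mu) by (apply Rdiv_lt_0_compat; lra).
  assert (lninv : forall z, 0 < z -> ln (1 / z) = - ln z).
  { intros z Hz. unfold Rdiv. rewrite Rmult_1_l. apply ln_Rinv, Hz. }
  exists (exp ld). split; [apply exp_pos|].
  (* At the minimiser the second term is l / (l - 1) times the first, so the sum is delta (2l - 1) /
     (l - 1). *)
  assert (T2 : A * exp (ln (exp ld / L) / l) / (mu ^ 2 * exp ld) = exp ld * (l / (l - 1))).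
  { apply (Rmult_eq_reg_r (mu ^ 2 * exp ld)).
    2:{ assert (H := exp_pos ld). assert (0 < mu ^ 2 * exp ld); [|lra].
        apply Rmult_lt_0_compat; [apply pow_lt|]; assumption. }
    replace (A * exp (ln (exp ld / L) / l) / (mu ^ 2 * exp ld) * (mu ^ 2 * exp ld))
      with (A * exp (ln (exp ld / L) / l))
      by (assert (H := exp_pos ld); field; lra).
    rewrite ln_div, ln_exp by (exact HL || apply exp_pos).
    rewrite <- (exp_ln A HA) at 1. rewrite <- (exp_ln (l / (l - 1)) Hll).
    fold lam. replace (mu ^ 2) with (exp (ln mu) * exp (ln mu)) by (rewrite exp_ln by exact Hmu; ring).
    rewrite <- !exp_plus. f_equal. unfold ld. field. lra. }
  rewrite T2. unfold kappa. fold (kernel l).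
  change (fun s => 1 / (rpow s l + 1)) with (kernel l).
  rewrite <- EA, !rpow_pos by assumption.
  rewrite !lninv by assumption. fold lam.
  replace (2 - 1 / l) with ((2 * l - 1) / (l - 1) * exp (- lam)).
  2:{ rewrite exp_Ropp. unfold lam. rewrite exp_ln by exact Hll. field. lra. }
  rewrite !Rmult_assoc, <- !exp_plus.
  replace (exp ld + exp ld * (l / (l - 1))) with ((2 * l - 1) / (l - 1) * exp ld) by (field; lra).
  f_equal. f_equal. unfold ld. field. lra.
Qed.

(* Explicit upper solution on [-a, 0]: (H3) bounds [F c + W - F] from below by
   [delta + L (s + a)^l]. *)
Lemma left_upper_solution (F g : R -> R) (a L l mu M v0 : R) :
  H1 F g a -> H3 F a L l -> 0 < mu ->
  is_max (fun r => exists x, 0 <= x <= a /\ r = g x) M ->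
  kappa M L l * rpow (1 / mu) (2 * l / (2 * l - 1)) <= v0 ->
  exists (delta : R) (W : R -> R), 0 < delta /\ W 0 <= v0 /\
    forall s, - a < s < 0 ->
      delta <= W s <= W 0 /\
      is_derive W s (- g s / (mu ^ 2 * (delta + L * rpow (s + a) l))).
Proof.
  intros HH (Hl & HL & _) Hmu [[xm [Hxm EM]] HM] Hk.
  assert (Ha : 0 < a) by apply HH.
  assert (gp : forall z, 0 < z -> 0 < g z) by apply HH.
  assert (og : odd_fun g) by apply HH.
  assert (HM0 : 0 < M).
  { apply (Rlt_le_trans _ (g a)); [apply gp, Ha|]. apply HM. exists a; split; [lra|reflexivity]. }
  set (N := RInt (kernel l) 0).
  set (I := RInt_gen (kernel l) (at_point 0) (Rbar_locally p_infty)).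
  assert (HNI : forall z, N z <= I) by (intros z; apply kernel_primitive_le_improper, Hl).
  assert (N0 : N 0 = 0) by apply (RInt_point (V := R_CompleteNormedModule)).
  assert (HI0 : 0 < I).
  { apply (Rlt_le_trans _ (N 1)); [|apply HNI].
    rewrite <- N0. apply kernel_primitive_incr; lra. }
  destruct (kappa_optimal M L l mu (M * I)) as [delta [Hd Ek]]; try assumption.
  { apply Rmult_lt_0_compat; assumption. }
  { reflexivity. }
  (* r = (delta / L)^(1/l) is the distance from -a at which L (s + a)^l equals delta; the scaling s
     + a = r z turns delta + L (s + a)^l into delta (1 + z^l). *)
  set (r := exp (ln (delta / L) / l)) in Ek.
  assert (Hr : 0 < r) by apply exp_pos.
  assert (Hm2 : 0 < mu ^ 2) by (apply pow_lt, Hmu).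
  set (w s := - g s / (mu ^ 2 * (delta + L * rpow (s + a) l))).
  assert (den : forall s, delta <= delta + L * rpow (s + a) l).
  { intros s. assert (H := rpow_nonneg (s + a) l).
    assert (0 <= L * rpow (s + a) l) by (apply Rmult_le_pos; lra). lra. }
  assert (Cw : forall s, continuous w s).
  { intros s. unfold w.
    apply (continuous_mult (fun s => - g s) (fun s => / (mu ^ 2 * (delta + L * rpow (s + a) l)))).
    - apply (continuous_opp g), (H1_continuous F g a s HH).
    - apply (continuous_comp (fun s => mu ^ 2 * (delta + L * rpow (s + a) l)) Rinv).
      + apply (continuous_mult (fun _ => mu ^ 2)); [apply continuous_const|].
        apply (continuous_plus (fun _ => delta)); [apply continuous_const|].
        apply (continuous_mult (fun _ => L)); [apply continuous_const|].
        apply (continuous_comp (fun s => s + a) (fun y => rpow y l)).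
        * apply (continuous_plus (fun s => s) (fun _ => a)); [apply continuous_id|apply continuous_const].
        * apply continuous_rpow; lra.
      + apply continuous_Rinv. assert (H := den s).
        apply Rgt_not_eq, Rmult_lt_0_compat; lra. }
  set (W s := delta + RInt w (- a) s).
  assert (DW : forall s, is_derive W s (w s)).
  { intros s. unfold W. evar_last.
    - apply (is_derive_plus (fun _ => delta) (RInt w (- a))); [apply is_derive_const|].
      apply (is_derive_RInt w _ (- a)); [|apply Cw].
      apply filter_forall. intros y. apply (RInt_correct (V := R_CompleteNormedModule)).
      apply (ex_RInt_continuous (V := R_CompleteNormedModule)); intros; apply Cw.
    - apply Rplus_0_l. }
  assert (CW : forall s, continuous W s)
    by (intros s; apply (ex_derive_continuous W); eexists; apply DW).
  assert (Wa : W (- a) = delta).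
  { unfold W. rewrite (RInt_point (V := R_CompleteNormedModule)). apply Rplus_0_r. }
  assert (wpos : forall s, s < 0 -> 0 < w s).
  { intros s Hs. unfold w. assert (H := g_neg F g a s HH Hs). assert (H' := den s).
    apply Rdiv_lt_0_compat; [lra|apply Rmult_lt_0_compat; lra]. }
  assert (Wmon : forall p q, p < q -> q <= 0 -> W p < W q).
  { intros p q Hpq Hq. apply derive_lt; [assumption| |intros; apply CW].
    intros s Hs. eexists; split; [apply DW|apply wpos; lra]. }
  exists delta, W. split; [exact Hd|]. split.
  2:{ intros s Hs. assert (Hlo := Wmon (- a) s ltac:(lra) ltac:(lra)).
      assert (Hhi := Wmon s 0 ltac:(lra) ltac:(lra)).
      split; [lra|apply DW]. }
  apply Rle_trans with (2 := Hk). rewrite <- Ek.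
  (* Replacing -g s by its bound M in W' gives the derivative of k N ((s + a) / r). So [B] is
     nondecreasing and W 0 <= delta + k N (a / r) <= delta + k I, the minimised height. *)
  set (k := M * r / (mu ^ 2 * delta)).
  assert (Hkp : 0 < k) by (unfold k; apply Rdiv_lt_0_compat; apply Rmult_lt_0_compat; lra).
  set (B s := k * N (/ r * (s + a)) - W s).
  assert (DN : forall z, is_derive N z (kernel l z))
    by (intros z; apply is_derive_kernel_primitive; lra).
  assert (DB : forall s, is_derive B s (k * (/ r * kernel l (/ r * (s + a))) - w s)).
  { intros s. unfold B.
    apply (is_derive_minus (fun s => k * N (/ r * (s + a))) W); [|apply DW].
    apply (is_derive_scal (fun s => N (/ r * (s + a)))).
    apply (is_derive_comp N (fun s => / r * (s + a))); [apply DN|].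
    auto_derive; [exact Logic.I|ring]. }
  assert (HB : 0 <= B 0 - B (- a)).
  { assert (H := derive_le B 0 (- a) 0 ltac:(lra)). rewrite Rmult_0_l in H. apply H.
    - intros s Hs. eexists; split; [apply DB|].
      assert (Hrp : rpow (/ r * (s + a)) l = rpow (s + a) l * (L / delta)).
      { assert (Hir : 0 < / r) by (apply Rinv_0_lt_compat, Hr).
        rewrite !rpow_pos by (try apply Rmult_lt_0_compat; lra).
        rewrite ln_mult, ln_Rinv by lra.
        unfold r. rewrite ln_exp, ln_div by lra.
        rewrite <- (exp_ln (L / delta)) by (apply Rdiv_lt_0_compat; lra).
        rewrite ln_div, <- exp_plus by lra. f_equal. field. lra. }
      assert (Hden := den s). assert (Hrn := rpow_nonneg (s + a) l).
      unfold kernel. rewrite Hrp.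
      assert (HgM : - g s <= M).
      { rewrite <- og. apply HM. exists (- s). split; [lra|reflexivity]. }
      replace (k * (/ r * (1 / (rpow (s + a) l * (L / delta) + 1))) - w s)
        with ((M - - g s) / (mu ^ 2 * (delta + L * rpow (s + a) l))).
      2:{ unfold k, w. field. repeat split; lra. }
      apply Rmult_le_pos; [lra|]. left. apply Rinv_0_lt_compat, Rmult_lt_0_compat; lra.
    - intros s _. apply (ex_derive_continuous B). eexists; apply DB. }
  unfold B in HB. rewrite Wa in HB.
  replace (/ r * (- a + a)) with 0 in HB by ring. rewrite N0 in HB.
  assert (HN1 : k * N (/ r * (0 + a)) <= k * I) by (apply Rmult_le_compat_l; [lra|apply HNI]).
  replace (M * I * r / (mu ^ 2 * delta)) with (k * I) by (unfold k; field; lra).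
  lra.
Qed.

(** * Conclusion *)

(** A passage from x = -a to x = 0 is compared with a left curve that ends at height at most v0 and
    not above the orbit; [reflected_barrier] then contradicts x <= c. *)
Lemma no_left_excursion (F g : R -> R) (a c L l mu v0 M T : R) (x y : R -> R) (tm : R) :
  H1 F g a -> 0 < c -> F c = F (- a) -> H2 F g c -> H3 F a L l -> 0 < mu ->
  0 < v0 -> Iint F g c v0 (- a) c = 0 ->
  is_max (fun r => exists x, 0 <= x <= a /\ r = g x) M ->
  kappa M L l * rpow (1 / mu) (2 * l / (2 * l - 1)) <= v0 ->
  lienard_solution mu F g x y ->
  0 < T -> (forall t, x (t + T) = x t /\ y (t + T) = y t) ->
  (forall t, x t <= c) -> x tm < - a -> False.
Proof.
  intros HH Hc Ec HH2 HH3 Hmu Hv0 HI HM Hk Hsol HT Hper Hxc Htm.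
  assert (Hac := H1_a_lt_c F g a c HH Hc Ec).
  destruct (left_passage F g a mu T x y tm) as (ta & t0 & Hta & Exa & Ex0 & Hya & Hin);
    try assumption.
  destruct (Rle_dec (y t0 / mu - F c) v0) as [Hle|Hgt].
  - (* the orbit itself is the left branch *)
    assert (Ymon : forall p q, ta <= p -> p < q -> q <= t0 -> y p / mu < y q / mu).
    { intros p q Hp Hpq Hq. apply Rmult_lt_compat_r; [apply Rinv_0_lt_compat, Hmu|].
      apply derive_lt; [assumption| |].
      - intros t Ht. destruct (Hsol t) as [_ Hy]. eexists; split; [exact Hy|].
        assert (H := g_neg F g a (x t) HH). assert (H' := Hin t ltac:(lra)). lra.
      - intros t _. exact (proj2 (lienard_continuous mu F g x y t Hsol)). }
    assert (Hw : 0 < y ta / mu - F c).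
    { rewrite Ec. apply (Rmult_lt_reg_r mu); [exact Hmu|]. field_simplify; lra. }
    (* Parametrised by time, with S = y / mu - F x and dX = mu S, the required slope of W is -g /
       mu, which is the derivative of y / mu - F c. *)
    apply (reflected_barrier F g a c mu v0 x y t0 x (fun t => y t / mu - F c)
             (fun t => y t / mu - F (x t)) ta t0 (y ta / mu - F c) (y t0 / mu - F c)
             (y ta / mu - F c)); try assumption; try lra.
    + intros t _. exact (proj1 (lienard_continuous mu F g x y t Hsol)).
    + intros t Ht. assert (Hx := Hin t Ht).
      assert (A := Ymon ta t ltac:(lra) ltac:(lra) ltac:(lra)).
      assert (B := Ymon t t0 ltac:(lra) ltac:(lra) ltac:(lra)).
      assert (C := F_lt_max F g a c (x t) HH HH2 Hc Ec ltac:(lra)).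
      assert (E : y t - mu * F (x t) = mu * (y t / mu - F (x t))) by (field; lra).
      destruct (Hsol t) as [Dx Dy].
      split; [lra|]. split; [lra|]. split; [lra|].
      exists (y t - mu * F (x t)). split; [|split].
      * rewrite E. apply Rmult_lt_0_compat; lra.
      * exact Dx.
      * evar_last.
        -- apply (is_derive_minus (fun t => y t / mu) (fun _ => F c)).
           ++ apply (is_derive_ext (fun t => scal (/ mu) (y t)));
                [intros; apply Rmult_comm|apply (is_derive_scal y), Dy].
           ++ apply is_derive_const.
        -- rewrite E. unfold minus, plus, opp, zero, scal, mult; simpl. unfold mult; simpl.
           set (S := y t / mu - F (x t)). field. unfold S; lra.
  (* The orbit passes x = 0 above v0 >= W 0. By (H3) and F c = -F a, delta + L (s + a)^l <= F c + W
     s - F s, so the explicit curve is admissible. *)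
  - destruct (left_upper_solution F g a L l mu M v0) as (delta & W & Hd & HW0 & HW);
      try assumption.
    destruct HH3 as (Hl & HL & H3').
    apply (reflected_barrier F g a c mu v0 x y t0 (fun s => s) W
             (fun s => delta + L * rpow (s + a) l) (- a) 0 delta (W 0) delta);
      try assumption; try lra.
    + assert (Ha : 0 < a) by apply HH. lra.
    + intros s _. apply continuous_id.
    + intros s Hs. destruct (HW s Hs) as [HWs DW].
      assert (P := rpow_nonneg (s + a) l).
      assert (0 <= L * rpow (s + a) l) by (apply Rmult_le_pos; lra).
      assert (B := H3' s ltac:(lra)).
      assert (oF : F (- a) = - F a) by apply HH.
      split; [exact Hs|]. split; [exact HWs|]. split; [lra|].
      exists 1. split; [lra|]. split; [apply (is_derive_id (K := R_AbsRing))|].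
      now rewrite Rmult_1_r.
Qed.

Theorem theorem1p5 (F g : R -> R) (a c L l mu v0 M : R)
  (hH1 : H1 F g a)
  (hc : 0 < c /\ F c = F (- a))
  (hH2 : H2 F g c)
  (hH3 : H3 F a L l)
  (hmu : 0 < mu)
  (hv0 : 0 < v0 /\ Iint F g c v0 (- a) c = 0)
  (hM : is_max (fun r => exists x, 0 <= x <= a /\ r = g x) M)
  (hkappa : kappa M L l * rpow (1 / mu) (2 * l / (2 * l - 1)) <= v0) :
  forall (Gamma : R * R -> Prop) (A : R),
    limit_cycle mu F g Gamma -> is_amplitude Gamma A -> c < A.
Proof.
  intros Gamma A [(x & y & Hsol & [T [HT Hper]] & Hne & HG) _] [_ HA].
  destruct hc as [Hc Ec]. destruct hv0 as [Hv0 HI].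
  apply Rnot_le_lt. intros HAc.
  assert (Hxc : forall t, - c <= x t <= c).
  { intros t. apply Rabs_le_between. apply Rle_trans with (2 := HAc). apply HA.
    exists (x t, y t). split; [|reflexivity]. apply HG. now exists t. }
  destruct (periodic_leaves_strip F g a mu T x y) as [tm Htm]; try assumption.
  (* An excursion beyond x = a becomes one beyond x = -a under the symmetry (x, y) -> (-x, -y),
     which also preserves |x| <= c. *)
  destruct (Rle_dec 0 (x tm)) as [Hpos|Hneg].
  - rewrite Rabs_right in Htm by lra.
    apply (no_left_excursion F g a c L l mu v0 M T (fun t => - x t) (fun t => - y t) tm);
      try assumption.
    + apply lienard_flip; [apply hH1|apply hH1|exact Hsol].
    + intros t. destruct (Hper t) as [-> ->]. split; reflexivity.
    + intros t. destruct (Hxc t). lra.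
    + lra.
  - rewrite Rabs_left in Htm by lra.
    apply (no_left_excursion F g a c L l mu v0 M T x y tm); try assumption.
    + intros t. apply Hxc.
    + lra.
Qed.
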